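(* Let $P_1,P_2\subset\mathbb{R}^d$ be rational convex polytopes such that $\dim(P_1+P_2)=d$, with rational denominators $\tau_1=\tau(P_1)$, $\tau_2=\tau(P_2)$, and put $\tau=(\tau_1,\tau_2)$. Let $Q(P_1,P_2;-):\mathbb{Q}^2_{\geq0}\to\mathbb{Q}$ be the rational quasi-polynomial of degree $d$ given by $$Q(P_1,P_2;\mathbf{r})=\#\left((r_1P_1+r_2P_2)\cap\mathbb{Z}^d\right)=\sum_{(l_1,l_2)\in\mathbb{Z}^2_{\geq0},\ l_1+l_2\leq d}p_{l_1,l_2}(\mathbf{r})\,r_1^{l_1}r_2^{l_2},\qquad \mathbf{r}=(r_1,r_2).$$ Then there is a finite set $\tilde S$ consisting of locally closed, bounded subsets of $\mathbb{R}^2_{>0}$, and a finite set of polynomials with rational coefficients $$\{f^U_{l_1,l_2}\mid U\in\tilde S,\ (l_1,l_2)\in\mathbb{Z}^2_{\geq0},\ l_1+l_2\leq d\}$$ such that: (1) $\mathbb{R}^2_{>0}=\bigcup_{U\in\tilde S}\bigcup_{\mathbf{u}\in\mathbb{Z}^2_{\geq0}}(U+\mathbf{u}\odot\tau)$, and $p_{l_1,l_2}(\mathbf{r})=f^U_{l_1,l_2}(\mathbf{r})$ for every $U\in\tilde S$, every $\mathbf{r}\in U\cap\mathbb{Q}^2_{>0}$ and every $(l_1,l_2)\in\mathbb{Z}^2_{\geq0}$ with $l_1+l_2\leq d$. (2) In particular, there exist nonnegative constants $C_{l_1,l_2}$ such that for all $\mathbf{r}\in\mathbb{Q}^2_{>0}$,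 $$|p_{l_1,l_2}(\mathbf{r})|\leq C_{l_1,l_2}\quad\text{and}\quad p_{l_1,d-l_1}(\mathbf{r})=C_{l_1,d-l_1}.$$
   Context: A polytope is rational (integral) if all its vertices have rational (integral) coordinates. The rational denominator $\tau(P)$ of a rational polytope $P$ is the smallest $\rho\in\mathbb{Q}_{>0}$ such that $\rho P$ is an integral polytope. $P_1+P_2$ is the Minkowski sum, and $\mathbf{u}\odot\tau=(u_1\tau_1,u_2\tau_2)$ is the coordinatewise product. By a theorem of McMullen, the function $Q(P_1,P_2;-)$ is a rational quasi-polynomial with period $\tau$: it has an expression as displayed, where each $p_{l_1,l_2}:\mathbb{Q}^2_{\geq0}\to\mathbb{Q}$ is periodic with period $\tau_i$ in the $i$-th argument ($i=1,2$). *)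

(* Defs.v *)
From mathcomp Require Export all_boot all_order all_algebra polyXY finmap.
From mathcomp Require Export all_classical all_reals topology normedtype.

Set Implicit Arguments.
Unset Strict Implicit.
Unset Printing Implicit Defensive.

Export Order.TTheory GRing.Theory Num.Theory numFieldNormedType.Exports.

Local Open Scope classical_set_scope.
Local Open Scope ring_scope.

Section Polytopes.
Variables (R : realType) (d : nat).
Implicit Types (A B P : set 'rV[R]_d) (v x y : 'rV[R]_d) (rho : rat).

Definition conv_hull (n : nat) (v : 'I_n -> 'rV[R]_d) : set 'rV[R]_d :=
  [set x | exists w : 'I_n -> R,
     [/\ forall i, 0 <= w i, \sum_i w i = 1 & x = \sum_i w i *: v i]].

Definition polytope P : Prop :=
  exists (n : nat) (v : 'I_n -> 'rV[R]_d), P = conv_hull v.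

Definition is_vertex P v : Prop :=
  P v /\ forall x y (t : R), P x -> P y -> 0 < t < 1 ->
    v = t *: x + (1 - t) *: y -> x = v /\ y = v.

Definition rat_points : set 'rV[R]_d :=
  range (fun q : 'rV[rat]_d => map_mx ratr q).

Definition int_points : set 'rV[R]_d :=
  range (fun z : 'rV[int]_d => map_mx intr z).

Definition rational_polytope P : Prop :=
  polytope P /\ is_vertex P `<=` rat_points.

Definition integral_polytope P : Prop :=
  polytope P /\ is_vertex P `<=` int_points.

Definition dilate rho A : set 'rV[R]_d := [set ratr rho *: x | x in A].

Definition minkowski_sum A B : set 'rV[R]_d := [set x + y | x in A & y in B].

(* For P = {0} every positive rho is admissible, so there is no smallest one
   and the relation below holds for no tau. *)
Definition is_rational_denominator P (tau : rat) : Prop :=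
  [/\ 0 < tau, integral_polytope (dilate tau P) &
      forall rho, 0 < rho -> integral_polytope (dilate rho P) -> tau <= rho].

(* A is nonempty and V is the direction space of its affine hull, i.e. the
   least linear subspace containing all differences of points of A. *)
Definition has_dim A (k : nat) : Prop :=
  A !=set0 /\ exists V : {vspace 'rV[R]_d},
    [/\ \dim V = k,
        forall x y, A x -> A y -> x - y \in V &
        forall W : {vspace 'rV[R]_d},
          (forall x y, A x -> A y -> x - y \in W) -> (V <= W)%VS].

(* fset_set is the empty set on infinite sets; here the set is finite whenever
   P1 and P2 are polytopes. *)
Definition lattice_count (P1 P2 : set 'rV[R]_d) (r : rat * rat) : rat :=
  #|` fset_set (minkowski_sum (dilate r.1 P1) (dilate r.2 P2)
                `&` int_points)|%:R.

End Polytopes.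

(* F and the p l1 l2 are functions on the nonnegative quadrant; their values
   elsewhere, and p l1 l2 for l1 + l2 > d, are irrelevant. *)
Definition quasi_polynomial_expansion (d : nat) (tau : rat * rat)
    (F : rat * rat -> rat) (p : nat -> nat -> rat * rat -> rat) : Prop :=
  (forall l1 l2 : nat, (l1 + l2 <= d)%N ->
     forall r : rat * rat, 0 <= r.1 -> 0 <= r.2 ->
       p l1 l2 (r.1 + tau.1, r.2) = p l1 l2 r /\
       p l1 l2 (r.1, r.2 + tau.2) = p l1 l2 r) /\
  (forall r : rat * rat, 0 <= r.1 -> 0 <= r.2 ->
     F r = \sum_(l1 < d.+1) \sum_(l2 < d.+1 | (l1 + l2 <= d)%N)
             p l1 l2 r * r.1 ^+ l1 * r.2 ^+ l2).

Section Plane.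
Variable R : realType.

Definition pos_quadrant : set (R * R) := [set x | 0 < x.1 /\ 0 < x.2].

Definition locally_closed (U : set (R * R)) : Prop :=
  exists O C : set (R * R), [/\ open O, closed C & U = O `&` C].

Definition ratr2 (r : rat * rat) : R * R := (ratr r.1, ratr r.2).

(* U + u (.) tau, with (.) the coordinatewise product. *)
Definition shift_set (tau : rat * rat) (U : set (R * R)) (u : nat * nat) :
    set (R * R) :=
  [set x + ratr2 (u.1%:R * tau.1, u.2%:R * tau.2) | x in U].

End Plane.
Arguments pos_quadrant : clear implicits.

(* Main.v *)
Require Import Defs.
From mathcomp Require Import qpoly ring lra zify.

Set Implicit Arguments.
Unset Strict Implicit.
Unset Printing Implicit Defensive.
Local Open Scope classical_set_scope.
Local Open Scope ring_scope.

(** Let F (r) be the number of lattice points of r1 P1 + r2 P2. Since tau1 P1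
    and tau2 P2 have integral vertices, the points counted by F (r) are the
    lattice points that are nonnegative combinations of finitely many lattice
    vectors, coloured by the polytope from which they come, with weights adding
    up to r1 / tau1 in the first colour and to r2 / tau2 in the second
    ([polytope_vertices], [mixed_dilate_hull]). All of the following concerns
    such counts.

    Piecewise polynomiality. For fixed r the values of F at the points
    r + (k1 tau1, k2 tau2) are, by periodicity, values of a single polynomial
    with coefficients [p l1 l2 r]. Interpolation at 0 <= k1, k2 <= d recovers
    [p l1 l2 r] from these values, by a formula that is polynomial in r
    ([coef_interpolation2], [coef_formula]); thus p is polynomial wherever these
    finitely many counts are constant. For r in the half-open rectangle with
    sides tau1 and tau2 only finitely many lattice points can contribute, and
    each of them does so on a closed set of parameters, as sets of weights are
    compact ([closed_mixed_hull_region]). Prescribing which of them contribute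
    cuts the rectangle into finitely many locally closed cells
    ([locally_closed_cell]), whose translates cover the quadrant. Boundedness
    of p follows, because counts and polynomials are bounded on the rectangle.

    Constancy in top degree. As P1 + P2 has full dimension, the dilates along
    r + n (k1 tau1, k2 tau2) and along n (k1 tau1, k2 tau2) can be translated by
    a lattice vector into each other, if n is increased by a constant
    ([lattice_points_translate]). Comparing the leading terms in n of the
    resulting inequalities between counts shows that the forms of degree d of
    the polynomials belonging to r and to 0 agree ([top_coef_constant]).

    Nonnegativity in top degree. The coefficients in question are mixed volumes,
    whose nonnegativity has a combinatorial proof. The lattice points of all
    s tau1 P1 + t tau2 P2, with s and t natural numbers, are obtained from
    finitely many of them by adding vertices. The lexicographically least such
    representations have exponent vectors that form a downset in N^n for each
    generator ([lex_minimal_down_closed]), and by Dickson's lemma the number of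
    elements of bidegree (s, t) of a downset is built from the count in no
    variables by shifts and summations ([EAM_count_downset]). This makes its
    mixed differences nonnegative for large s and t, and the differences of
    order d of a polynomial of degree d are its top coefficients up to
    factorials ([EAM_top_coef_ge0]). *)

(** * Functions with eventually nonnegative mixed differences *)

Section Differences.
Variable K : numDomainType.
Implicit Types f g : nat -> nat -> K.

Definition diff1 f : nat -> nat -> K := fun s t => f s.+1 t - f s t.
Definition diff2 f : nat -> nat -> K := fun s t => f s t.+1 - f s t.
Definition mixed_diff (a b : nat) f := iter a diff1 (iter b diff2 f).
Definition flip f : nat -> nat -> K := fun s t => f t s.

Lemma diff12 f : diff1 (diff2 f) = diff2 (diff1 f).
Proof. by apply/funext => s; apply/funext => t; rewrite /diff1 /diff2; ring. Qed.

Lemma mixed_diffS1 a b f : mixed_diff a.+1 b f = mixed_diff a b (diff1 f).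
Proof.
rewrite /mixed_diff iterSr; congr (iter a _ _).
by elim: b => //= b <-; rewrite diff12.
Qed.

Lemma mixed_diffS2 a b f : mixed_diff a b.+1 f = mixed_diff a b (diff2 f).
Proof. by rewrite /mixed_diff iterSr. Qed.

Lemma mixed_diff_flip a b f : mixed_diff a b (flip f) = flip (mixed_diff b a f).
Proof.
elim: a b f => [|a IHa] b f.
  elim: b f => [|b IHb] f //.
  by rewrite mixed_diffS2 mixed_diffS1 -IHb.
by rewrite mixed_diffS1 mixed_diffS2 -IHa.
Qed.

Lemma mixed_diff_sum (I : Type) (r : seq I) (F : I -> nat -> nat -> K) a b s t :
  mixed_diff a b (fun s t => \sum_(i <- r) F i s t) s t =
  \sum_(i <- r) mixed_diff a b (F i) s t.
Proof.
elim: a b F s t => [|a IHa] b F s t.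
  elim: b F s t => [|b IHb] F s t //.
  rewrite mixed_diffS2 -(eq_bigr _ (fun i _ => erefl)).
  under eq_bigr do rewrite mixed_diffS2.
  rewrite -IHb; congr (mixed_diff _ _ _ _ _).
  by apply/funext => s'; apply/funext => t'; rewrite /diff2 -sumrB.
under eq_bigr do rewrite mixed_diffS1.
rewrite mixed_diffS1 -IHa; congr (mixed_diff _ _ _ _ _).
by apply/funext => s'; apply/funext => t'; rewrite /diff1 -sumrB.
Qed.

Lemma mixed_diff0 a b s t : mixed_diff a b (fun _ _ => 0) s t = 0.
Proof.
have E := @mixed_diff_sum nat [::] (fun _ _ _ => 0) a b s t.
rewrite [RHS]big_nil in E; rewrite -[RHS]E.
congr (mixed_diff _ _ _ _ _).
by apply/funext => s'; apply/funext => t'; rewrite big_nil.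
Qed.

(** A polynomial of degree d with this property has nonnegative coefficients
    in degree d: up to factorials they are its differences of order d. In a
    direction that is not differenced ([a] or [b] equal to 0) nonnegativity is
    required everywhere, not only far out; otherwise the property would not
    pass to [cumul1], which sums over the initial values too. *)
Definition eventually_absolutely_monotone f :=
  forall a b : nat, exists N : nat, forall s t : nat,
    ((a == 0) || (N <= s))%N -> ((b == 0) || (N <= t))%N -> 0 <= mixed_diff a b f s t.

Local Notation EAM := eventually_absolutely_monotone.

Lemma EAM_flip f : EAM f -> EAM (flip f).
Proof.
move=> Hf a b; have [N HN] := Hf b a; exists N => s t Hs Ht.
by rewrite mixed_diff_flip; apply: HN.
Qed.

Lemma EAM_sum (I : Type) (r : seq I) (F : I -> nat -> nat -> K) :
  (forall i, EAM (F i)) -> EAM (fun s t => \sum_(i <- r) F i s t).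
Proof.
move=> HF a b.
have [N HN] : exists N : nat, forall s t : nat,
  ((a == 0) || (N <= s))%N -> ((b == 0) || (N <= t))%N ->
    0 <= \sum_(i <- r) mixed_diff a b (F i) s t.
  elim: r => [|i r [N HN]]; first by exists 0%N => s t; rewrite big_nil.
  have [M HM] := HF i a b; exists (maxn N M) => s t.
  rewrite !geq_max => Hs Ht; rewrite big_cons addr_ge0 //.
    by apply: HM; [move: Hs|move: Ht]; case: eqP => //= _ /andP[].
  by apply: HN; [move: Hs|move: Ht]; case: eqP => //= _ /andP[].
by exists N => s t Hs Ht; rewrite mixed_diff_sum; apply: HN.
Qed.

Definition shift1 (k : nat) f : nat -> nat -> K :=
  fun s t => if (k <= s)%N then f (s - k)%N t else 0.

Definition cumul1 f : nat -> nat -> K := fun s t => \sum_(j < s.+1) f j t.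

(** The jump of [shift1 k f] is at [s = k]; differences in the first direction
    taken from [k] on do not see it. *)
Lemma mixed_diff_shift1 k a b f s t : (k <= s)%N || (a == 0)%N ->
  mixed_diff a b (shift1 k f) s t = shift1 k (mixed_diff a b f) s t.
Proof.
move=> /orP H.
elim: b f => [|b IHb] f; last first.
  rewrite !mixed_diffS2 -IHb //; congr (mixed_diff _ _ _ _ _).
  apply/funext => s'; apply/funext => t'; rewrite /diff2 /shift1.
  by case: ifP => //; rewrite subrr.
case: H => [|/eqP ->] //.
elim: a s t f => [|a IHa] s t f ks //.
rewrite /mixed_diff /= -/(mixed_diff a 0 (shift1 k f)) -/(mixed_diff a 0 f).
rewrite {1}/diff1 !IHa ?(leqW ks) // /shift1 (leqW ks) ks /diff1.
by rewrite subSn.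
Qed.

Lemma EAM_shift1 k f : EAM f -> EAM (shift1 k f).
Proof.
move=> Hf a b; have [N HN] := Hf a b; exists (N + k)%N => s t Hs Ht.
rewrite mixed_diff_shift1; last by move: Hs; case: eqP => //= _; lia.
rewrite /shift1; case: ifP => // ks; apply: HN.
  by move: Hs; case: eqP => //= _; lia.
by move: Ht; case: eqP => //= _; lia.
Qed.

Lemma diff1_cumul1 f : diff1 (cumul1 f) = fun s t => f s.+1 t.
Proof.
apply/funext => s; apply/funext => t.
by rewrite /diff1 /cumul1 big_ord_recr /= addrAC subrr add0r.
Qed.

Lemma mixed_diff_succ1 a b f s t :
  mixed_diff a b (fun s t => f s.+1 t) s t = mixed_diff a b f s.+1 t.
Proof.
elim: a b f s t => [|a IHa] b f s t.
  by elim: b f s t => [|b IHb] f s t //; rewrite !mixed_diffS2 -IHb.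
by rewrite !mixed_diffS1 -IHa.
Qed.

(** Cumulation is undone by one difference in the first direction, so that only
    [a = 0] involves the initial values of [f]. *)
Lemma EAM_cumul1 f : EAM f -> EAM (cumul1 f).
Proof.
move=> Hf [|a] b; last first.
  have [N HN] := Hf a b; exists N => s t Hs Ht.
  rewrite mixed_diffS1 diff1_cumul1 mixed_diff_succ1; apply: HN => //.
  by rewrite (leqW Hs) orbT.
have [N HN] := Hf 0%N b; exists N => s t _ Ht.
have -> : mixed_diff 0 b (cumul1 f) s t = \sum_(j < s.+1) mixed_diff 0 b f j t.
  elim: b f {Hf HN Ht} => // b IHb f.
  rewrite mixed_diffS2; under eq_bigr do rewrite mixed_diffS2.
  rewrite -IHb; congr (mixed_diff _ _ _ _ _).
  by apply/funext => s'; apply/funext => t'; rewrite /diff2 /cumul1 -sumrB.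
by apply: sumr_ge0 => j _; apply: HN.
Qed.

(** The count of monomials in no variables is of this kind. *)
Lemma EAM_origin f : 0 <= f 0%N 0%N -> (forall s t, (0 < s + t)%N -> f s t = 0) ->
  EAM f.
Proof.
have main g a b s t : (forall s t, (0 < s + t)%N -> g s t = 0) ->
    mixed_diff a b g s.+1 t = 0.
  move=> g0; rewrite -mixed_diff_succ1 -[RHS](mixed_diff0 a b s t).
  congr (mixed_diff _ _ _ _ _).
  by apply/funext => s'; apply/funext => t'; rewrite g0.
move=> f00 f0 a b; exists 1%N => -[|s] t; last by rewrite main.
case: a => // _; case: b => [_|b]; first by case: t => // t; rewrite /mixed_diff /= f0.
case: t => // t _; rewrite -[f]/(flip (flip f)) mixed_diff_flip /flip main //.
by move=> s' t' st; rewrite f0 // addnC.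
Qed.

End Differences.
Local Notation EAM := eventually_absolutely_monotone.

(** * Counting exponent vectors in a downset *)

(** The convolution is the sum of finitely many shifts and one shifted
    cumulative sum, because [F k] no longer varies from [k0] on. *)
Lemma EAM_convolution (K : numDomainType) (F : nat -> nat -> nat -> K) k0 :
  (forall k, EAM (F k)) -> (forall k, (k0 <= k)%N -> F k = F k0) ->
  EAM (fun s t => \sum_(k < s.+1) F k (s - k)%N t).
Proof.
move=> HF Fk0.
have -> : (fun s t => \sum_(k < s.+1) F k (s - k)%N t) = fun s t =>
    \sum_(b <- [:: true; false])
      (if b then fun s t => \sum_(k < k0) shift1 k (F k) s t
       else shift1 k0 (cumul1 (F k0))) s t.
  apply/funext => s; apply/funext => t.
  rewrite !big_cons big_nil addr0 /shift1 /cumul1.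
  rewrite -(big_mkord xpredT (fun k => F k (s - k)%N t)).
  rewrite -(big_mkord xpredT (fun k => if (k <= s)%N then F k (s - k)%N t else 0)).
  case: leqP => [k0s|sk0].
    rewrite (@big_cat_nat _ _ _ k0) //=; last exact: leqW.
    congr (_ + _).
      by apply: eq_big_nat => k /andP[_ kk0]; rewrite ifT // (leq_trans (ltnW kk0)).
    rewrite -{1}[k0]add0n big_addn big_mkord subSn //.
    rewrite (reindex_inj rev_ord_inj) /=; apply: eq_bigr => i _.
    have := ltn_ord i; rewrite Fk0 ?leq_addl // => ?.
    by congr (F k0 _ t); lia.
  rewrite addr0 [RHS](@big_cat_nat _ _ _ s.+1) //=.
  rewrite [X in _ + X]big_nat_cond [X in _ + X]big1 ?addr0.
    by apply: eq_big_nat => k /andP[_]; rewrite ltnS => ->.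
  by move=> k /andP[/andP[sk _] _]; rewrite leqNgt sk.
apply: EAM_sum => -[]; last exact/EAM_shift1/EAM_cumul1.
by apply: EAM_sum => k; exact/EAM_shift1.
Qed.

Definition down_closed (n : nat) (D : pred (seq nat)) :=
  forall j e, (j < n)%N -> size e = n -> D (incr_nth e j) -> D e.

Lemma down_closed_cons n D k : down_closed n.+1 D -> down_closed n (fun e => D (k :: e)).
Proof. by move=> HD j e jn en; apply: (HD j.+1 (k :: e)) => //=; rewrite en. Qed.

Lemma down_closed_head n D k l e : down_closed n.+1 D -> size e = n ->
  (k <= l)%N -> D (l :: e) -> D (k :: e).
Proof.
move=> HD en /subnK <-; elim: (l - k)%N => // i IH H; apply: IH.
by apply: (HD 0%N (i + k :: e)%N) => //=; rewrite en.
Qed.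

(** Dickson's lemma as a descending chain condition, by induction on the
    number of coordinates. Sliced by the first coordinate, a chain of downsets
    decreases in both indices; its diagonal is constant from some [J] on, and
    this settles all slices of height at least [J]. Each of the finitely many
    lower slices stabilizes by induction. *)
Lemma downset_chain_stabilizes n (D : nat -> pred (seq nat)) :
  (forall k, down_closed n (D k)) ->
  (forall k l e, (k <= l)%N -> size e = n -> D l e -> D k e) ->
  exists k0, forall k e, (k0 <= k)%N -> size e = n -> D k e = D k0 e.
Proof.
elim: n D => [|n IH] D HD Dmono.
  have [[k Dk]|H] := pselect (exists k, ~~ D k [::]).
    exists k => l e kl /size0nil ->; rewrite (negbTE Dk).
    by apply/negP => /(Dmono _ _ [::] kl erefl); apply/negP.
  have HT k : D k [::] by apply: contrapT => /negP H'; apply: H; exists k.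
  by exists 0%N => k e _ /size0nil ->; rewrite !HT.
have step k l i j e : (k <= l)%N -> (i <= j)%N -> size e = n ->
    D l (j :: e) -> D k (i :: e).
  move=> kl ij en H; apply: (down_closed_head (HD k) en ij).
  by apply: (Dmono _ _ _ kl) H; rewrite /= en.
have [J HJ] : exists J, forall k e, (J <= k)%N -> size e = n ->
    D k (k :: e) = D J (J :: e).
  apply: (IH (fun k e => D k (k :: e))) => [k|k l e kl en].
    exact: down_closed_cons.
  exact: step.
have [M HM] : exists M, forall i k e, (i < J)%N -> (M <= k)%N -> size e = n ->
    D k (i :: e) = D M (i :: e).
  elim: (J) => [|J' [M HM]]; first by exists 0%N.
  have [M' HM'] := IH (fun k e => D k (J' :: e)) (fun k => down_closed_cons (HD k))
    (fun k l e kl en => step k l J' J' e kl (leqnn _) en).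
  exists (maxn M M') => i k e; rewrite ltnS leq_eqVlt geq_max => + /andP[Mk M'k] en.
  case/orP => [/eqP ->|iJ].
    by rewrite HM' // [RHS]HM' // leq_maxr.
  by rewrite HM // [RHS]HM // leq_maxl.
exists (maxn M J) => k [//|i e]; rewrite geq_max => /andP[Mk Jk] [en].
have [iJ|Ji] := ltnP i J; first by rewrite HM // [RHS]HM // leq_maxl.
have diag l : (J <= l)%N -> D l (i :: e) = D J (J :: e).
  move=> Jl; apply/idP/idP; first exact: step.
  rewrite -(HJ (maxn l i)) ?(leq_trans Jl) ?leq_maxl //.
  by apply: step; rewrite ?leq_maxl ?leq_maxr.
by rewrite !diag // leq_maxr.
Qed.

(** The monomials of bidegree (s, t) in variables of bidegree (1, 0), marked
    [true] in [bs], and (0, 1), marked [false]. *)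
Fixpoint exponents (bs : seq bool) (s t : nat) : seq (seq nat) :=
  match bs with
  | [::] => if (s == 0%N) && (t == 0%N) then [:: [::]] else [::]
  | b :: bs' =>
    [seq k :: e | k <- iota 0 (if b then s else t).+1,
                  e <- if b then exponents bs' (s - k) t else exponents bs' s (t - k)]
  end.

Definition degx (bs : seq bool) (e : seq nat) := sumn (mask bs e).
Definition degy (bs : seq bool) (e : seq nat) := sumn (mask (map negb bs) e).

Lemma exponents_cons b bs s t : exponents (b :: bs) s t =
  [seq k :: e | k <- iota 0 (if b then s else t).+1,
                e <- if b then exponents bs (s - k) t else exponents bs s (t - k)].
Proof. by []. Qed.

Lemma mem_exponents bs s t e :
  (e \in exponents bs s t) = [&& size e == size bs, degx bs e == s & degy bs e == t].
Proof.
elim: bs s t e => [|b bs IH] s t e; last rewrite exponents_cons.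
  case: e => [|? ?]; last by rewrite /=; case: ifP.
  rewrite /degx /degy /= ![0%N == _]eq_sym.
  by case: ifP => // _; rewrite inE.
apply/allpairsPdep/idP => [[k [e' []]]|].
  rewrite mem_iota add0n ltnS => /andP[_ ks] He' ->; move: ks He'.
  by case: b; rewrite IH /degx /degy /= eqSS => ks /and3P[-> /eqP E1 /eqP E2] /=;
    lia.
case: e => [/andP[] //|k e] H; exists k, e; split => //; move: H.
  by rewrite mem_iota /degx /degy; case: (b) => /= /and3P[_ /eqP ? /eqP ?]; lia.
by case: (b); rewrite IH /degx /degy /= eqSS => /and3P[-> /eqP <- /eqP <-];
  rewrite addKn !eqxx.
Qed.

Lemma exponents_uniq bs s t : uniq (exponents bs s t).
Proof.
elim: bs s t => [|b bs IH] s t; first by rewrite /=; case: ifP.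
rewrite exponents_cons.
apply: allpairs_uniq_dep; first exact: iota_uniq.
  by move=> k _; case: b.
by move=> /= [k e] [l f] _ _ [-> ->].
Qed.

(** Slicing by the first exponent presents the count as a convolution of counts
    in one variable less, whose slices are eventually constant. *)
Lemma EAM_count_downset (K : numDomainType) bs (D : pred (seq nat)) :
  down_closed (size bs) D -> EAM (fun s t => (count D (exponents bs s t))%:R : K).
Proof.
elim: bs D => [|b bs IH] D HD.
  apply: EAM_origin => [|[|s] [|t]] //=; exact: ler0n.
have [k0 Hk0] : exists k0, forall k e, (k0 <= k)%N -> size e = size bs ->
    D (k :: e) = D (k0 :: e).
  apply: (downset_chain_stabilizes (D := fun k e => D (k :: e))) => [k|k l e kl en].
    exact: down_closed_cons.
  exact: (down_closed_head HD en kl).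
have step : EAM (fun s t => \sum_(k < s.+1)
   (count (fun e => D (val k :: e)) (if b then exponents bs (s - k) t
       else exponents bs t (s - k)))%:R : K).
  case: b {HD} (HD) => HD.
    apply: (EAM_convolution (k0 := k0) (F := fun k s t =>
      (count (fun e => D (k :: e)) (exponents bs s t))%:R)) => [k|k kk0].
      exact/IH/down_closed_cons.
    apply/funext => s; apply/funext => t; congr (_%:R); apply: eq_in_count => e.
    by rewrite mem_exponents => /and3P[/eqP es _ _]; apply: Hk0.
  apply: (EAM_convolution (k0 := k0) (F := fun k s t =>
    (count (fun e => D (k :: e)) (exponents bs t s))%:R)) => [k|k kk0].
    by apply: (EAM_flip (IH _ _)); apply: down_closed_cons.
  apply/funext => s; apply/funext => t; congr (_%:R); apply: eq_in_count => e.
  by rewrite mem_exponents => /and3P[/eqP es _ _]; apply: Hk0.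
have count_cons s' t' : count D (exponents (b :: bs) s' t') =
    (\sum_(k < (if b then s' else t').+1) count (fun e => D (val k :: e))
       (if b then exponents bs (s' - k) t' else exponents bs s' (t' - k)))%N.
  rewrite exponents_cons count_flatten sumnE !big_map -[iota 0 _]/(index_iota 0 (_.+1 - 0)).
  by rewrite subn0 big_mkord; case: (b); apply: eq_bigr => k _; rewrite count_map.
case: b HD step count_cons => HD step count_cons.
  move: step; congr (EAM _); apply/funext => s; apply/funext => t.
  by rewrite count_cons natr_sum.
move: (EAM_flip step); congr (EAM _); apply/funext => s; apply/funext => t.
by rewrite count_cons natr_sum.
Qed.

(** * Least representations of the points of a bigraded set *)

(** Every fibre of [phi] on the finite list [L] has exactly one [lt]-least
    element. *)
Lemma size_undup_map_min (A T : eqType) (phi : A -> T) (lt : rel A) (L : seq A) :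
  uniq L -> irreflexive lt -> transitive lt ->
  {in L &, forall x y, x != y -> lt x y || lt y x} ->
  size (undup (map phi L)) =
  count (fun x => all (fun y => (phi y == phi x) ==> ~~ lt y x) L) L.
Proof.
move=> uL irr tr tot; set P := (X in count X L).
rewrite -size_filter -(size_map phi); apply/perm_size/uniq_perm.
- exact: undup_uniq.
- rewrite map_inj_in_uniq ?filter_uniq // => x y.
  rewrite !mem_filter => /andP[/allP Px xL] /andP[/allP Py yL] exy.
  apply/eqP; apply: contraT => /(tot _ _ xL yL).
  have := Px _ yL; have := Py _ xL; rewrite exy eqxx /=.
  by move=> /negbTE -> /negbTE ->.
move=> z; rewrite mem_undup; apply/mapP/mapP => -[x xL ->]; last first.
  by exists x => //; move: xL; rewrite mem_filter => /andP[].
have [n] := ubnP (count (fun y => (phi y == phi x) && lt y x) L).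
elim: n x xL => // n IH x xL; rewrite ltnS => cn.
have [Px|/allPn [y yL]] := boolP (P x).
  by exists x => //; rewrite mem_filter Px.
rewrite negb_imply negbK => /andP[/eqP eyx lyx]; rewrite -eyx; apply: IH => //.
apply: leq_trans cn.
rewrite !(permP (perm_to_rem yL)) /= irr andbF eyx eqxx lyx /= ltnS.
by apply: sub_count => w /= /andP[-> lwy]; rewrite (tr _ _ _ lwy lyx).
Qed.

Fixpoint lex_lt (e f : seq nat) : bool :=
  match e, f with
  | k :: e', l :: f' => (k < l)%N || (k == l) && lex_lt e' f'
  | _, _ => false
  end.

Lemma lex_lt_irr : irreflexive lex_lt.
Proof. by elim=> //= k e ->; rewrite ltnn andbF. Qed.

Lemma lex_lt_trans : transitive lex_lt.
Proof.
elim=> [|l f IH] [|k e] [|m g] //=.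
case/orP => [kl|/andP[/eqP -> ef]]; case/orP => [lm|/andP[/eqP <- fg]].
- by rewrite (ltn_trans kl lm).
- by rewrite kl.
- by rewrite lm.
- by rewrite eqxx (IH _ _ ef fg) orbT.
Qed.

Lemma lex_lt_total e f : size e = size f -> e != f -> lex_lt e f || lex_lt f e.
Proof.
elim: e f => [|k e IH] [|l f] //= [/IH ef]; rewrite eqseq_cons.
by case: ltngtP => //= _ /ef.
Qed.

(** The lexicographic order is a monomial order; this is why the minimal
    representations below form a downset. *)
Lemma lex_lt_incr_nth e f j : size e = size f -> (j < size e)%N ->
  lex_lt (incr_nth e j) (incr_nth f j) = lex_lt e f.
Proof.
elim: e f j => [|k e IH] [|l f] [|j] //= [ef] je.
by rewrite IH.
Qed.

Section GradedModule.
Variables (K : numDomainType) (V : zmodType).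
Variables (bs : seq bool) (vs : seq V) (gs : seq (V * nat * nat)).
Hypothesis size_vs : size vs = size bs.

Definition lin_comb (e : seq nat) : V := \sum_(j < size vs) vs`_j *+ nth 0%N e j.

(** A monomial [e] acting on the [i]-th generator, together with the bidegree of
    the result. *)
Definition pointed (i : nat) (e : seq nat) : V * nat * nat :=
  let g := nth (0, 0%N, 0%N) gs i in
  (g.1.1 + lin_comb e, (g.1.2 + degx bs e)%N, (g.2 + degy bs e)%N).

Lemma lin_comb_incr_nth e j : (j < size vs)%N ->
  lin_comb (incr_nth e j) = lin_comb e + vs`_j.
Proof.
move=> jv; rewrite /lin_comb (bigD1 (Ordinal jv)) //= [in RHS](bigD1 (Ordinal jv)) //=.
rewrite nth_incr_nth eqxx mulrnDr mulr1n [vs`_j + _]addrC addrAC; congr (_ + _ + _).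
by apply: eq_bigr => i; rewrite nth_incr_nth -val_eqE eq_sym /= => /negbTE ->.
Qed.

Lemma degx_incr_nth cs e j : size e = size cs -> (j < size cs)%N ->
  degx cs (incr_nth e j) = (degx cs e + nth false cs j)%N.
Proof.
elim: cs e j => [|b cs IH] [|k e] [|j] //= [ec] jc; rewrite /degx /=.
  by case: b => /=; lia.
by have := IH e j ec jc; rewrite /degx; case: b => /= ->; rewrite ?addnA.
Qed.

Lemma degy_incr_nth cs e j : size e = size cs -> (j < size cs)%N ->
  degy cs (incr_nth e j) = (degy cs e + ~~ nth false cs j)%N.
Proof.
move=> ec jc; rewrite -[degy cs _]/(degx (map negb cs) _) degx_incr_nth ?size_map //.
by rewrite (nth_map false).
Qed.

Lemma pointed_incr_nth i e i' e' j : size e = size bs -> size e' = size bs ->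
  (j < size bs)%N -> pointed i e = pointed i' e' ->
  pointed i (incr_nth e j) = pointed i' (incr_nth e' j).
Proof.
move=> es e's jb []; rewrite /pointed !lin_comb_incr_nth ?size_vs //.
rewrite !degx_incr_nth // !degy_incr_nth // => Ev Ex Ey.
by congr (_, _, _); [rewrite !addrA Ev | rewrite !addnA Ex | rewrite !addnA Ey].
Qed.

(** The complement of the leading monomials of the relations, as for the initial
    module of a module over a polynomial ring. The index of the generator is
    compared before the exponents. *)
Definition lex_minimal (i : nat) (e : seq nat) : bool :=
  `[< forall i' e', (i' < size gs)%N -> size e' = size bs ->
        lex_lt (i' :: e') (i :: e) -> pointed i' e' <> pointed i e >].

(** A smaller rival of [e] stays a smaller rival of [incr_nth e j] when its own
    [j]-th exponent is incremented too. *)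
Lemma lex_minimal_down_closed i : down_closed (size bs) (lex_minimal i).
Proof.
move=> j e jb es /asboolP H; apply/asboolP => i' e' i's e's lt eq.
apply: (H i' (incr_nth e' j)) => //.
- by rewrite size_incr_nth e's jb.
- by move: lt; rewrite /= lex_lt_incr_nth ?e's.
- exact: pointed_incr_nth.
Qed.

Definition representations s t : seq (seq nat) :=
  [seq i :: e | i <- iota 0 (size gs),
     e <- let g := nth (0, 0%N, 0%N) gs i in
          if (g.1.2 <= s)%N && (g.2 <= t)%N
          then exponents bs (s - g.1.2) (t - g.2) else [::]].

Lemma mem_representations s t f : f \in representations s t <->
  exists i e, [/\ f = i :: e, (i < size gs)%N, size e = size bs &
     (pointed i e).1.2 = s /\ (pointed i e).2 = t].
Proof.
split.
  move=> /allpairsPdep[i [e []]]; rewrite mem_iota => /andP[_ igs] /=.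
  case: ifP => // /andP[gx gy]; rewrite mem_exponents => /and3P[/eqP es /eqP ex /eqP ey] ->.
  exists i, e; split => //; rewrite /= ex ey; lia.
move=> [i [e [-> igs es [/= es' et]]]]; apply/allpairsPdep; exists i, e.
rewrite mem_iota igs; split => //=.
rewrite ifT; last by lia.
by rewrite mem_exponents es eqxx /=; lia.
Qed.

Lemma representations_uniq s t : uniq (representations s t).
Proof.
apply: allpairs_uniq_dep; first exact: iota_uniq.
  by move=> i _ /=; case: ifP => // _; exact: exponents_uniq.
by move=> /= [k e] [l f] _ _ [-> ->].
Qed.

(** The combinatorial core of the fact that the top coefficients of a bigraded
    Hilbert polynomial are nonnegative: as the points of a finitely generated
    bigraded set correspond to their least representations, their number is a
    finite sum of shifted counts of downsets, one for each generator. *)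
Lemma EAM_graded_module (M : nat -> nat -> seq V) :
  (forall s t, uniq (M s t)) ->
  (forall s t x, x \in M s t <->
     exists i e, [/\ (i < size gs)%N, size e = size bs & pointed i e = (x, s, t)]) ->
  EAM (fun s t => (size (M s t))%:R : K).
Proof.
move=> Mu memM.
pose pt f := (pointed (head 0%N f) (behead f)).1.1.
have -> : (fun s t => (size (M s t))%:R : K) = fun s t =>
   \sum_(i <- iota 0 (size gs)) shift1 (nth (0, 0%N, 0%N) gs i).1.2
     (flip (shift1 (nth (0, 0%N, 0%N) gs i).2 (flip (fun s t =>
        (count (lex_minimal i) (exponents bs s t))%:R)))) s t.
  apply/funext => s; apply/funext => t.
  have -> : size (M s t) = size (undup (map pt (representations s t))).
    apply/perm_size/uniq_perm => //; first exact: undup_uniq.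
    move=> x; rewrite mem_undup; apply/idP/mapP.
      move/memM => [i [e [igs es E]]]; exists (i :: e); last by rewrite /pt [pointed _ _]E.
      by apply/mem_representations; exists i, e; rewrite E.
    move=> [f /mem_representations [i [e [-> igs es [E1 E2]]]] ->].
    apply/memM; exists i, e; split => //.
    by rewrite -E1 -E2 /pt; case: (pointed _ _) => [[]].
  rewrite (size_undup_map_min _ (lt := lex_lt)); last first.
  - move=> f g /mem_representations [i [e [-> _ es _]]].
    move=> /mem_representations [i' [e' [-> _ es' _]]] ne.
    by apply: lex_lt_total => //=; rewrite es es'.
  - exact: lex_lt_trans.
  - exact: lex_lt_irr.
  - exact: representations_uniq.
  have -> : count (fun f => all (fun g => (pt g == pt f) ==> ~~ lex_lt g f)
      (representations s t)) (representations s t) =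
      count (fun f => lex_minimal (head 0%N f) (behead f)) (representations s t).
    apply: eq_in_count => f /mem_representations [i [e [-> igs es [E1 E2]]]] /=.
    apply/allP/asboolP => H.
      move=> i' e' i's e's lt E.
      have := H (i' :: e'); rewrite /pt [pointed _ _]E eqxx lt /= => F.
      apply: notF; apply: F.
      by apply/mem_representations; exists i', e'; rewrite E.
    move=> g /mem_representations [i' [e' [-> i's e's [E1' E2']]]].
    apply/implyP => /eqP E; apply/negP => lt; apply: (H i' e' i's e's lt).
    have {E} : (pointed i' e').1.1 = (pointed i e).1.1 := E.
    move: E1 E2 E1' E2'.
    by case: (pointed i e) (pointed i' e') => [[? ?] ?] [[? ?] ?] /= -> -> -> -> ->.
  rewrite /representations count_flatten sumnE !big_map natr_sum.
  apply: eq_bigr => i _; rewrite count_map /shift1 /flip /=.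
  by case: (leq _ s) => //; case: (leq _ t).
apply: EAM_sum => i; apply/EAM_shift1/EAM_flip/EAM_shift1/EAM_flip.
exact/EAM_count_downset/lex_minimal_down_closed.
Qed.

End GradedModule.

(** * Differences, leading coefficients and interpolation of polynomials *)

Section Monomials.
Variable K : numDomainType.
Implicit Types u v : nat -> K.

Definition fdiff u : nat -> K := fun s => u s.+1 - u s.

Lemma fdiffE u s : fdiff u s = u s.+1 - u s. Proof. by []. Qed.

Lemma mixed_diff_prod a b u v s t :
  mixed_diff a b (fun s t => u s * v t) s t = iter a fdiff u s * iter b fdiff v t.
Proof.
elim: a u s t => [|a IHa] u s t.
  elim: b v s t => [|b IHb] v s t //.
  rewrite mixed_diffS2 iterSr -IHb; congr (mixed_diff _ _ _ _ _).
  by apply/funext => s'; apply/funext => t'; rewrite /diff2 /fdiff mulrBr.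
rewrite mixed_diffS1 iterSr -IHa; congr (mixed_diff _ _ _ _ _).
by apply/funext => s'; apply/funext => t'; rewrite /diff1 /fdiff mulrBl.
Qed.

(** The Leibniz rule, in which [l.-1] is harmless because of the factor [l]. *)
Lemma fdiff_mulX l u s : iter l fdiff (fun s => s%:R * u s) s =
  s%:R * iter l fdiff u s + l%:R * iter l.-1 fdiff u s.+1.
Proof.
elim: l s => [|l IH] s; first by rewrite mul0r addr0.
rewrite iterS fdiffE !IH; case: l {IH} => [|l] /=; rewrite !fdiffE -!natr1; ring.
Qed.

Lemma fdiff_exp l a s : (a <= l)%N ->
  iter l fdiff (fun s => s%:R ^+ a) s = (if a == l then l`!%:R else 0) :> K.
Proof.
elim: a l s => [|a IH] l s al.
  case: l al => [|l] _ //.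
  have E x : iter l.+1 fdiff (fun=> x) s = 0 :> K.
    elim: l x => [|l IHl] x; first by rewrite /= /fdiff subrr.
    rewrite iterSr -[RHS](IHl 0); congr (iter _ _ _ _).
    by apply/funext => s'; rewrite /fdiff subrr.
  exact: E.
rewrite (_ : (fun s => _) = fun s => s%:R * s%:R ^+ a); last first.
  by apply/funext => s'; rewrite exprS.
case: l al => // l al; rewrite fdiff_mulX /= -/(iter l.+1 fdiff _) !IH //; last exact: ltnW.
rewrite eqSS (ltn_eqF (al : (a < l.+1)%N)) mulr0 add0r factS natrM.
by case: eqP; rewrite ?mulr0.
Qed.

Lemma mixed_diff_monomial a b i j s t : (i + j <= a + b)%N ->
  mixed_diff a b (fun s t => s%:R ^+ i * t%:R ^+ j) s t =
    (if (i == a) && (j == b) then (a`! * b`!)%:R else 0) :> K.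
Proof.
move=> ij; rewrite mixed_diff_prod.
have [ia|ai] := leqP i a; last first.
  rewrite (gtn_eqF ai) /= [X in _ * X]fdiff_exp; last by lia.
  by rewrite ltn_eqF ?mulr0 //; lia.
rewrite fdiff_exp //; case: eqP => [ea|]; last by rewrite mul0r.
rewrite fdiff_exp; last by lia.
by case: eqP => _ /=; rewrite ?natrM ?mulr0.
Qed.

Lemma mixed_diff_scale (c : K) f a b s t :
  mixed_diff a b (fun s t => c * f s t) s t = c * mixed_diff a b f s t.
Proof.
elim: a f s t => [|a IHa] f s t.
  elim: b f s t => [|b IHb] f s t //.
  rewrite !mixed_diffS2 -IHb; congr (mixed_diff _ _ _ _ _).
  by apply/funext => s'; apply/funext => t'; rewrite /diff2 mulrBr.
rewrite !mixed_diffS1 -IHa; congr (mixed_diff _ _ _ _ _).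
by apply/funext => s'; apply/funext => t'; rewrite /diff1 mulrBr.
Qed.

(** Among the monomials of degree at most [a + b], the differences of order
    [(a, b)] annihilate all but s^a t^b, which they turn into a! b!. *)
Lemma EAM_top_coef_ge0 d (c : nat -> nat -> K) a b :
  EAM (fun s t => \sum_(i < d.+1) \sum_(j < d.+1 | (i + j <= d)%N)
         c i j * (s%:R ^+ i * t%:R ^+ j)) ->
  (a + b = d)%N -> 0 <= c a b.
Proof.
move=> /(_ a b)[N /(_ N N)]; rewrite !leqnn !orbT => /(_ isT isT) + abd.
rewrite mixed_diff_sum.
have ad : (a < d.+1)%N by lia.
have bd : (b < d.+1)%N by lia.
have E (i : 'I_d.+1) : mixed_diff a b (fun s t : nat =>
    \sum_(j < d.+1 | (i + j <= d)%N) c i j * (s%:R ^+ i * t%:R ^+ j)) N N =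
    if i == Ordinal ad then c a b * (a`! * b`!)%:R else 0.
  have -> : (fun s t : nat => \sum_(j < d.+1 | (i + j <= d)%N)
       c i j * (s%:R ^+ i * t%:R ^+ j)) = fun s t => \sum_(j < d.+1)
     (if (i + j <= d)%N then c i j else 0) * (s%:R ^+ i * t%:R ^+ j).
    apply/funext => s; apply/funext => t; rewrite big_mkcond; apply: eq_bigr => j _.
    by case: ifP; rewrite ?mul0r.
  rewrite mixed_diff_sum (bigD1 (Ordinal bd)) //= big1 ?addr0 => [|j].
    rewrite mixed_diff_scale -val_eqE /=; case: leqP => id; last first.
      by rewrite mul0r gtn_eqF //; lia.
    rewrite mixed_diff_monomial; last by lia.
    by rewrite eqxx andbT; case: eqP => [->|]; rewrite ?mulr0.
  rewrite -val_eqE /= => /negbTE jb; rewrite mixed_diff_scale.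
  case: leqP => id; last by rewrite mul0r.
  rewrite mixed_diff_monomial; last by lia.
  by rewrite jb andbF mulr0.
rewrite (eq_bigr _ (fun i _ => E i)) -big_mkcond big_pred1_eq.
by rewrite pmulr_lge0 // ltr0n muln_gt0 !fact_gt0.
Qed.

End Monomials.

(** Otherwise the values at large [n] would be negative. *)
Lemma ge0_top_coef (q : {poly rat}) d : (size q <= d.+1)%N ->
  (forall n : nat, 0 <= q.[n%:R]) -> 0 <= q`_d.
Proof.
move=> sq q0; rewrite leNgt; apply/negP => qd.
have sqE : size q = d.+1.
  apply/eqP; rewrite eqn_leq sq ltnNge; apply/negP => /(nth_default 0) E.
  by rewrite E ltxx in qd.
have lq : lead_coef q = q`_d by rewrite lead_coefE sqE.
have mq : (q`_d)^-1 *: q \is monic.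
  by rewrite monicE lead_coefZ lq mulVf // lt_eqF.
have [b Hb] := monic_Cauchy_bound mq.
have [n nb] : exists n : nat, b <= n%:R.
  exists (Num.bound `|b|).
  exact: le_trans (ler_norm b) (ltW (archi_boundP (normr_ge0 _))).
have := Hb _ nb; rewrite hornerZ; apply/negP; rewrite -leNgt.
by rewrite nmulr_rle0 ?invr_lt0.
Qed.

(** Interpolate q (r + tau X) at the nodes 0, ..., n, which do not depend on [r],
    and substitute (X - r) / tau back for X. As the Lagrange polynomials are
    fixed, [r] enters the coefficients polynomially. *)
Lemma coef_interpolation (K : numFieldType) (n : nat) (tau : K) : tau != 0 ->
  exists c : nat -> nat -> {poly K}, forall (q : {poly K}) r l,
    (size q <= n.+1)%N ->
    q`_l = \sum_(k < n.+1) q.[r + k%:R * tau] * (c k l).[r].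
Proof.
move=> tau0; pose x (i : nat) : K := i%:R.
have x_inj : injective x by move=> i j /eqP; rewrite eqr_nat => /eqP.
pose lag (k : nat) : {poly K} := \val (nth 0 (lagrange n.+1 x) k).
pose C k := map_poly polyC (lag k) \Po (tau^-1%:P%:P * ('X - 'X%:P)).
exists (fun k l => (C k)`_l) => q r l sq.
pose u := tau *: 'X + r%:P; pose w := tau^-1 *: ('X - r%:P).
have uw : u \Po w = 'X.
  rewrite /u /w comp_polyD comp_polyZ comp_polyX comp_polyC scalerA mulfV //.
  by rewrite scale1r subrK.
have CE k : map_poly (horner_eval r) (C k) = lag k \Po w.
  have -> : lag k = map_poly (horner_eval r) (map_poly polyC (lag k)).
    rewrite -map_poly_comp map_poly_id // => y _.
    by rewrite /= /horner_eval hornerC.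
  rewrite /C map_comp_poly; congr (_ \Po _).
  rewrite rmorphM rmorphB /= !map_polyC /= map_polyX.
  by rewrite /horner_eval hornerC hornerX mul_polyC.
have quE : q \Po u = \sum_(k < n.+1) q.[r + k%:R * tau]%:P * lag k.
  rewrite [LHS](lagrange_gen (n := n.+1) _ x_inj) //; last first.
    apply: leq_trans sq; rewrite size_comp_poly2 // /u.
    rewrite size_polyDl ?size_scale // size_polyX //.
    by rewrite size_polyC; case: (r != 0).
  apply: eq_bigr => k _; rewrite /lag -nth_lagrange; congr (_%:P * _).
  by rewrite horner_comp !hornerE addrC mulrC.
rewrite -{1}[q]comp_polyXr -uw comp_polyA quE raddf_sum /= coef_sum.
apply: eq_bigr => k _; rewrite rmorphM /= comp_polyC coefCM -CE coef_map.
by [].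
Qed.

Lemma coef_interpolation2 (K : numFieldType) (n : nat) (tau1 tau2 : K) :
  tau1 != 0 -> tau2 != 0 ->
  exists c1 c2 : nat -> nat -> {poly K}, forall (a : nat -> nat -> K) r1 r2 l1 l2,
    (l1 <= n)%N -> (l2 <= n)%N ->
    a l1 l2 = \sum_(k1 < n.+1) \sum_(k2 < n.+1)
      (\sum_(i < n.+1) \sum_(j < n.+1)
         a i j * (r1 + k1%:R * tau1) ^+ i * (r2 + k2%:R * tau2) ^+ j) *
      ((c1 k1 l1).[r1] * (c2 k2 l2).[r2]).
Proof.
move=> /(coef_interpolation n)[c1 H1] /(coef_interpolation n)[c2 H2].
exists c1, c2 => a r1 r2 l1 l2 l1n l2n.
pose q := \poly_(i < n.+1) a i l2.
have -> : a l1 l2 = q`_l1 by rewrite coef_poly ltnS l1n.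
rewrite (H1 q r1) ?size_poly //; apply: eq_bigr => k1 _.
pose q' := \poly_(j < n.+1) (\sum_(i < n.+1) a i j * (r1 + k1%:R * tau1) ^+ i).
have -> : q.[r1 + k1%:R * tau1] = q'`_l2.
  by rewrite coef_poly ltnS l2n horner_poly.
rewrite (H2 q' r2) ?size_poly // mulr_suml; apply: eq_bigr => k2 _.
rewrite mulrAC -mulrA; congr (_ * _).
rewrite horner_poly exchange_big /=; apply: eq_bigr => j _.
by rewrite mulr_suml.
Qed.

Lemma coefM_top (K : nzRingType) (p q : {poly K}) a b :
  (size p <= a.+1)%N -> (size q <= b.+1)%N ->
  (size (p * q)%R <= (a + b).+1)%N /\ (p * q)`_(a + b) = p`_a * q`_b.
Proof.
move=> sp sq; split.
  by apply: (leq_trans (size_polyMleq _ _)); lia.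
have ab : (a < (a + b).+1)%N by lia.
rewrite coefM (bigD1 (Ordinal ab)) //= addKn big1 ?addr0 // => i.
rewrite -val_eqE /= neq_ltn => /orP[ia|ai].
  by rewrite [q`__]nth_default ?mulr0 // (leq_trans sq) //; lia.
by rewrite nth_default ?mul0r // (leq_trans sp).
Qed.

Lemma coef_top_linear_exp (K : nzRingType) (x y : K) n :
  (size ((x%:P + y *: 'X) ^+ n)%R <= n.+1)%N /\ ((x%:P + y *: 'X) ^+ n)`_n = y ^+ n.
Proof.
have s1 : (size (x%:P + y *: 'X : {poly K})%R <= 2)%N.
  rewrite (leq_trans (size_polyD _ _)) // geq_max (leq_trans (size_polyC_leq1 _)) //.
  by rewrite (leq_trans (size_scale_leq _ _)) // size_polyX.
elim: n => [|n [sn cn]]; first by rewrite !expr0 size_poly1 coefC.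
rewrite !exprS; have [s' c'] := @coefM_top _ _ _ 1 n s1 sn.
split; first exact: s'.
by rewrite -[n.+1]/((1 + n)%N) c' cn coefD coefZ coefX coefC /= add0r mulr1.
Qed.

Section TopForm.
Variable d : nat.
Implicit Types (c e : nat -> nat -> rat).

Definition bipoly_value c (x y : rat) : rat :=
  \sum_(i < d.+1) \sum_(j < d.+1 | (i + j <= d)%N) c i j * x ^+ i * y ^+ j.

Definition top_form c (x y : rat) : rat :=
  \sum_(i < d.+1) c i (d - i)%N * x ^+ i * y ^+ (d - i)%N.

(** Both sides are polynomials of degree at most [d] in [n], and their
    coefficients of n^d are the top forms wherever the lines start. *)
Lemma top_form_le c e (x0 y0 x1 y1 b1 b2 : rat) :
  (forall n : nat, bipoly_value c (x0 + n%:R * b1) (y0 + n%:R * b2) <=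
                   bipoly_value e (x1 + n%:R * b1) (y1 + n%:R * b2)) ->
  top_form c b1 b2 <= top_form e b1 b2.
Proof.
pose Q c (x y : rat) : {poly rat} :=
  \sum_(i < d.+1) \sum_(j < d.+1 | (i + j <= d)%N)
    c i j *: ((x%:P + b1 *: 'X) ^+ i * (y%:P + b2 *: 'X) ^+ j).
have Qn c' x y (n : nat) : (Q c' x y).[n%:R] =
    bipoly_value c' (x + n%:R * b1) (y + n%:R * b2).
  rewrite horner_sum; apply: eq_bigr => i _; rewrite horner_sum; apply: eq_bigr => j _.
  by rewrite hornerZ hornerM !horner_exp !hornerE (mulrC b1) (mulrC b2).
have sM (x y : rat) i j : (i + j <= d)%N ->
    (size ((x%:P + b1 *: 'X) ^+ i * (y%:P + b2 *: 'X) ^+ j)%R <= (i + j).+1)%N /\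
    ((x%:P + b1 *: 'X) ^+ i * (y%:P + b2 *: 'X) ^+ j)`_(i + j) = b1 ^+ i * b2 ^+ j.
  move=> ij; have [s1 e1] := coef_top_linear_exp x b1 i.
  have [s2 e2] := coef_top_linear_exp y b2 j.
  by have [s3 e3] := coefM_top s1 s2; rewrite e3 e1 e2.
have sQ c' x y : (size (Q c' x y) <= d.+1)%N.
  apply: (leq_trans (size_sum _ _ _)); apply/bigmax_leqP => i _.
  apply: (leq_trans (size_sum _ _ _)); apply/bigmax_leqP => j ij.
  apply: (leq_trans (size_scale_leq _ _)).
  by apply: (leq_trans (sM _ _ _ _ ij).1); rewrite ltnS.
have cQ c' x y : (Q c' x y)`_d = top_form c' b1 b2.
  rewrite coef_sum; apply: eq_bigr => i _; rewrite coef_sum.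
  have di : (d - i < d.+1)%N by lia.
  have id := ltn_ord i.
  rewrite (bigD1 (Ordinal di)) /=; last by rewrite subnKC.
  rewrite [X in _ + X]big1 ?addr0; last first.
    move=> j /andP[ij]; rewrite -val_eqE /= => ji; rewrite coefZ nth_default ?mulr0 //.
    by apply: (leq_trans (sM _ _ _ _ ij).1); lia.
  have [|_] := sM x y i (d - i)%N; rewrite subnKC // => E.
  by rewrite coefZ E mulrA.
move=> H; rewrite -subr_ge0 -(cQ c x0 y0) -(cQ e x1 y1) -coefB.
apply: ge0_top_coef.
  by apply: (leq_trans (size_polyD _ _)); rewrite size_polyN geq_max !sQ.
by move=> n; rewrite hornerD hornerN subr_ge0 !Qn.
Qed.

(** Already [k2 = 1] leaves infinitely many roots to the polynomial in one variable
    obtained from the difference of the two forms. *)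
Lemma top_form_inj c e (t1 t2 : rat) : 0 < t1 -> 0 < t2 ->
  (forall k1 k2 : nat, (0 < k1)%N -> (0 < k2)%N ->
     top_form c (k1%:R * t1) (k2%:R * t2) = top_form e (k1%:R * t1) (k2%:R * t2)) ->
  forall i, (i <= d)%N -> c i (d - i)%N = e i (d - i)%N.
Proof.
move=> t10 t20 H i id.
pose q := \poly_(i < d.+1) ((c i (d - i)%N - e i (d - i)%N) * t1 ^+ i * t2 ^+ (d - i)).
have q0 : q = 0.
  apply: (@roots_geq_poly_eq0 _ _ [seq n.+1%:R | n <- iota 0 d.+1]).
  - apply/allP => _ /mapP[n _ ->]; rewrite rootE horner_poly.
    have /eqP := H n.+1 1%N isT isT; rewrite -subr_eq0 -sumrB mul1r => /eqP E.
    apply/eqP; rewrite -[RHS]E; apply: eq_bigr => j _; rewrite exprMn; ring.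
  - rewrite map_inj_uniq ?iota_uniq // => m n /eqP.
    by rewrite eqr_nat eqSS => /eqP.
  - by rewrite size_map size_iota size_poly.
have := coef_poly d.+1 (fun i => (c i (d - i)%N - e i (d - i)%N) * t1 ^+ i * t2 ^+ (d - i)) i.
rewrite -/q q0 coef0 ltnS id => /esym/eqP.
rewrite !mulf_eq0 subr_eq0 !expf_eq0 (gt_eqF t10) (gt_eqF t20) !andbF !orbF.
by move=> /eqP.
Qed.

End TopForm.

(** * Polytopes as hulls of their vertices *)

Section HullVertices.
Variables (R : realType) (d : nat).
Implicit Types (P : set 'rV[R]_d).

Definition scaled_hull (n : nat) (v : 'I_n -> 'rV[R]_d) (s : R) : set 'rV[R]_d :=
  [set x | exists w : 'I_n -> R,
     [/\ forall i, 0 <= w i, \sum_i w i = s & x = \sum_i w i *: v i]].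

(** The convex combination can be solved for [v i], since its weight there is
    less than 1. *)
Lemma redundant_point n (v : 'I_n.+1 -> 'rV[R]_d) i (c : 'I_n.+1 -> R) :
  (forall j, 0 <= c j) -> \sum_j c j = 1 -> c i != 1 -> v i = \sum_j c j *: v j ->
  conv_hull v = conv_hull (v \o lift i).
Proof.
move=> c0 c1 ci vi; have ci1 : c i < 1.
  by rewrite lt_neqAle ci -c1 (bigD1_ord i) //= lerDl sumr_ge0.
have vE : v i = \sum_j (c (lift i j) / (1 - c i)) *: v (lift i j).
  apply: (@scalerI _ _ (1 - c i)); first by rewrite subr_eq0 eq_sym.
  rewrite scaler_sumr scalerBl scale1r {1}vi (bigD1_ord i) //= addrAC subrr add0r.
  apply: eq_bigr => j _; rewrite scalerA mulrC divfK //.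
  by rewrite subr_eq0 eq_sym.
have sc : \sum_j c (lift i j) / (1 - c i) = 1.
  rewrite -mulr_suml -[in X in _ / X]c1 (bigD1_ord i) //= addrAC subrr add0r divff //.
  have : c i + \sum_j c (lift i j) = 1 by rewrite -c1 [in RHS](bigD1_ord i).
  by move=> E; apply/eqP => E0; move: E; rewrite E0 addr0 => /eqP; rewrite (negbTE ci).
apply/seteqP; split => x [w [w0 w1 ->]].
  exists (fun j => w (lift i j) + w i * (c (lift i j) / (1 - c i))); split.
  - by move=> j; rewrite addr_ge0 // mulr_ge0 // divr_ge0 // subr_ge0 ltW.
  - by rewrite big_split /= -mulr_sumr sc mulr1 -w1 [in RHS](bigD1_ord i) //= addrC.
  - rewrite [LHS](bigD1_ord i) //= {1}vE scaler_sumr -big_split /=.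
    by apply: eq_bigr => j _; rewrite scalerDl scalerA addrC.
exists (fun j => if unlift i j is Some k then w k else 0); split.
- by move=> j; case: unlift.
- rewrite (bigD1_ord i) //= unlift_none add0r -w1.
  by apply: eq_bigr => j _; rewrite liftK.
- rewrite [in RHS](bigD1_ord i) //= unlift_none scale0r add0r.
  by apply: eq_bigr => j _; rewrite liftK.
Qed.

(** In a spanning family of least size every member is a vertex: if it lies
    strictly between two points, then mixing the weights of these gives weights
    that, for lack of redundancy, are concentrated on that member. *)
Lemma polytope_vertices P : polytope P ->
  exists n (v : 'I_n -> 'rV[R]_d), P = conv_hull v /\ forall i, is_vertex P (v i).
Proof.
move=> [n [v ->]]; elim: n v => [|n IH] v.
  by exists 0%N, v; split => // -[].
have [[i [c [c0 c1 ci vi]]]|nored] := pselect (exists i c,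
    [/\ forall j, 0 <= c j, \sum_j c j = 1, c i != 1 & v i = \sum_j c j *: v j]).
  by rewrite (redundant_point c0 c1 ci vi); exact: IH.
exists n.+1, v; split => // i.
have unit_weight c : (forall j, 0 <= c j) -> \sum_j c j = 1 -> c i = 1 ->
    \sum_j c j *: v j = v i.
  move=> c0 c1 ci; have cj j : j != i -> c j = 0.
    move=> ji; apply/eqP; rewrite eq_le c0 andbT -(lerD2l (c i)) addr0 ci -[leRHS]c1.
    by rewrite (bigD1 i) //= (bigD1 j) //= ci lerD2l lerDl sumr_ge0.
  by rewrite (bigD1 i) //= ci scale1r big1 ?addr0 // => j /cj ->; rewrite scale0r.
split.
  exists (fun j => (j == i)%:R); split => [j||]; first exact: ler0n.
    by rewrite (bigD1 i) //= eqxx big1 ?addr0 // => j /negbTE ->.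
  by rewrite (bigD1 i) //= eqxx scale1r big1 ?addr0 // => j /negbTE ->; rewrite scale0r.
move=> x y t [a [a0 a1 ->]] [b [b0 b1 ->]] /andP[t0 t1] vi.
pose c j := t * a j + (1 - t) * b j.
have c0 j : 0 <= c j by rewrite addr_ge0 // mulr_ge0 // ?subr_ge0 ltW.
have c1 : \sum_j c j = 1.
  by rewrite big_split /= -!mulr_sumr a1 b1 !mulr1 addrC subrK.
have vc : v i = \sum_j c j *: v j.
  rewrite {1}vi !scaler_sumr -big_split /=; apply: eq_bigr => j _.
  by rewrite /c [in RHS]scalerDl !scalerA.
have ci : c i = 1.
  by apply/eqP; apply: contraT => ci; case: nored; exists i, c.
have le1 w : (forall j : 'I_n.+1, 0 <= w j) -> \sum_j w j = 1 -> w i <= 1 :> R.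
  by move=> w0 <-; rewrite (bigD1 i) //= lerDl sumr_ge0.
have ai := le1 _ a0 a1; have bi := le1 _ b0 b1.
have ai1 : a i = 1 by move: ci; rewrite /c; nra.
have bi1 : b i = 1 by move: ci; rewrite /c; nra.
by rewrite !unit_weight.
Qed.

Lemma integral_polytope_hull P : integral_polytope P ->
  exists n (z : 'I_n -> 'rV[int]_d), P = conv_hull (fun i => map_mx intr (z i)).
Proof.
move=> [/polytope_vertices [n [v [PE vP]]] vint].
have /choice [z zE] : forall i, exists z : 'rV[int]_d, map_mx intr z = v i.
  by move=> i; have [z _ zv] := vint _ (vP i); exists z.
by exists n, z; rewrite PE; congr (conv_hull _); apply/funext => i; rewrite zE.
Qed.

(** At [s = 0] the right-hand side is the origin even for an empty family, whence
    the nonemptiness of [P]. *)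
Lemma dilate_hull P (tau : rat) n (v : 'I_n -> 'rV[R]_d) s : P !=set0 ->
  0 < tau -> dilate tau P = conv_hull v -> 0 <= s ->
  dilate s P = scaled_hull v (ratr (s / tau)).
Proof.
move=> [p0 Pp0] tau0 PE s0.
have tR : 0 < ratr tau :> R by rewrite ltr0q.
have tR0 := lt0r_neq0 tR.
apply/seteqP; split => x.
  move=> [p Pp <-].
  have : dilate tau P (ratr tau *: p) by exists p.
  rewrite PE => -[w [w0 w1 wE]].
  exists (fun i => ratr (s / tau) * w i); split.
  - by move=> i; rewrite mulr_ge0 // ler0q divr_ge0 // ltW.
  - by rewrite -mulr_sumr w1 mulr1.
  - under eq_bigr do rewrite -scalerA.
    by rewrite -scaler_sumr -wE scalerA fmorph_div divfK.
move=> [w [w0 w1 ->]].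
have [s00|sn0] := eqVneq s 0.
  exists p0 => //; rewrite s00 raddf0 scale0r big1 // => i _.
  have : \sum_j w j == 0 by rewrite w1 s00 mul0r raddf0.
  rewrite psumr_eq0 // => /allP /(_ i); rewrite mem_index_enum => /(_ isT) /= /eqP ->.
  by rewrite scale0r.
pose c : R := ratr (s / tau).
have c0 : 0 < c by rewrite ltr0q divr_gt0 // lt_neqAle eq_sym sn0.
have : conv_hull v (\sum_i (w i / c) *: v i).
  exists (fun i => w i / c); split => //; first by move=> i; rewrite divr_ge0 // ltW.
  by rewrite -mulr_suml w1 divff // lt0r_neq0.
rewrite -PE => -[p Pp pE]; exists p => //.
have -> : ratr s = c * ratr tau :> R by rewrite /c fmorph_div divfK.
rewrite -scalerA pE scaler_sumr; apply: eq_bigr => i _.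
by rewrite scalerA mulrC divfK // lt0r_neq0.
Qed.

End HullVertices.

(** * Lattice points of two-coloured hulls *)

(** One family [v] serves both polytopes; [col] tells to which of them its
    members belong. *)
Definition mixed_hull (R : realType) (d N : nat) (col : pred 'I_N)
    (v : 'I_N -> 'rV[R]_d) (x y : R) : set 'rV[R]_d :=
  [set u | exists w : 'I_N -> R,
     [/\ forall i, 0 <= w i, \sum_(i | col i) w i = x,
         \sum_(i | ~~ col i) w i = y & u = \sum_i w i *: v i]].

Lemma minkowski_sum_hull (R : realType) (d n m : nat)
    (v1 : 'I_n -> 'rV[R]_d) (v2 : 'I_m -> 'rV[R]_d) x y :
  minkowski_sum (scaled_hull v1 x) (scaled_hull v2 y) =
  mixed_hull (fun i : 'I_(n + m) => if fintype.split i is inl _ then true else false)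
    (fun i : 'I_(n + m) =>
       match fintype.split i with inl j => v1 j | inr j => v2 j end) x y.
Proof.
have sl j : fintype.split (lshift m j) = inl j := unsplitK (inl j).
have sr j : fintype.split (rshift n j) = inr j := unsplitK (inr j).
apply/seteqP; split => u.
  move=> [_ [a [a0 a1 ->]] [_ [b [b0 b1 ->]] <-]].
  exists (fun i => match fintype.split i with inl j => a j | inr j => b j end); split.
  - by move=> i; case: fintype.split.
  - rewrite big_mkcond big_split_ord /= [X in _ + X]big1 ?addr0; last first.
      by move=> j _; rewrite sr.
    by rewrite -a1; apply: eq_bigr => j _; rewrite sl.
  - rewrite big_mkcond big_split_ord /= [X in X + _]big1 ?add0r; last first.
      by move=> j _; rewrite sl.
    by rewrite -b1; apply: eq_bigr => j _; rewrite sr.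
  - rewrite big_split_ord /=; congr (_ + _); apply: eq_bigr => j _.
      by rewrite sl.
    by rewrite sr.
move=> [w [w0 w1 w2 ->]].
exists (\sum_i w (lshift m i) *: v1 i).
  exists (fun i => w (lshift m i)); split => //.
  rewrite -w1 [RHS]big_mkcond big_split_ord /=.
  rewrite [X in _ + X]big1 ?addr0; last by move=> j _; rewrite sr.
  by apply: eq_bigr => j _; rewrite sl.
exists (\sum_i w (rshift n i) *: v2 i).
  exists (fun i => w (rshift n i)); split => //.
  rewrite -w2 [RHS]big_mkcond big_split_ord /=.
  rewrite [X in X + _]big1 ?add0r; last by move=> j _; rewrite sl.
  by apply: eq_bigr => j _; rewrite sr.
rewrite big_split_ord /=; congr (_ + _); apply: eq_bigr => j _.
  by rewrite sl.
by rewrite sr.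
Qed.

Lemma int_box_finite (d B : nat) : exists s : seq 'rV[int]_d,
  uniq s /\ forall c : 'rV[int]_d, (forall k, `|c ord0 k| <= B%:Z) -> c \in s.
Proof.
pose T := {ffun 'I_d -> 'I_(B + B).+1}.
exists (undup [seq \row_k ((f k : nat)%:Z - B%:Z) | f : T <- enum T]).
split; first exact: undup_uniq.
move=> c cB; rewrite mem_undup; apply/mapP.
exists [ffun k => inord (absz (c ord0 k + B%:Z))].
  by rewrite mem_enum.
apply/rowP => k; rewrite mxE ffunE.
move: (cB k); rewrite [c 0 k]/(c ord0 k). move: (c ord0 k) => z zB; rewrite inordK; lia.
Qed.

Section LatticePoints.
Variables (R : realType) (d N : nat) (col : pred 'I_N) (v : 'I_N -> 'rV[int]_d).

Definition realify (c : 'rV[int]_d) : 'rV[R]_d := map_mx intr c.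

Lemma realifyD a b : realify (a + b) = realify a + realify b.
Proof. exact: raddfD. Qed.

Lemma realifyB a b : realify (a - b) = realify a - realify b.
Proof. exact: raddfB. Qed.

Lemma realifyMn a n : realify (a *+ n) = n%:R *: realify a.
Proof. by rewrite /realify raddfMn scaler_nat. Qed.

Lemma realify_sum (I : Type) (r : seq I) (P : pred I) F :
  realify (\sum_(i <- r | P i) F i) = \sum_(i <- r | P i) realify (F i).
Proof. exact: raddf_sum. Qed.

Lemma realify_inj : injective realify.
Proof.
move=> a b /rowP ab; apply/rowP => k.
by have := ab k; rewrite !mxE => /intr_inj.
Qed.

Definition lattice_in (x y : R) (c : 'rV[int]_d) : Prop :=
  mixed_hull col (fun i => realify (v i)) x y (realify c).

Definition entry_bound : nat := (\sum_i \sum_k `|v i ord0 k|)%N.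

Lemma lattice_in_bounded x y c k : lattice_in x y c ->
  `|c ord0 k| <= (entry_bound * (Num.truncn (x + y)).+1)%:Z.
Proof.
move=> [w [w0 wx wy cE]].
have sw : \sum_i w i = x + y by rewrite (bigID col) /= wx wy.
have E : (c ord0 k)%:~R = \sum_i w i * (v i ord0 k)%:~R :> R.
  transitivity (realify c ord0 k); first by rewrite mxE.
  by rewrite cE summxE; apply: eq_bigr => i _; rewrite !mxE.
have vB i : `|(v i ord0 k)%:~R| <= entry_bound%:R :> R.
  rewrite -intr_norm -[entry_bound%:R]/(entry_bound%:Z%:~R) ler_int -abszE lez_nat.
  by rewrite /entry_bound (bigD1 i) //= (bigD1 k) //= -addnA leq_addr.
rewrite -(ler_int R) intr_norm E (le_trans (ler_norm_sum _ _ _)) //.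
apply: (@le_trans _ _ (\sum_i w i * entry_bound%:R)).
  by apply: ler_sum => i _; rewrite normrM (ger0_norm (w0 i)) ler_wpM2l.
rewrite -mulr_suml sw mulrC -[(_ * _)%:Z%:~R]/((entry_bound * _)%:R) natrM.
by rewrite ler_wpM2l // ltW // truncnS_gt.
Qed.

Lemma lattice_in_box (M : R) : exists s : seq 'rV[int]_d,
  forall x y c, x + y <= M -> lattice_in x y c -> c \in s.
Proof.
have [s [_ sP]] := int_box_finite d (entry_bound * (Num.truncn M).+1).
exists s => x y c xyM /lattice_in_bounded cB; apply: sP => k.
by apply: (le_trans (cB k)); rewrite lez_nat leq_mul // ltnS le_truncn.
Qed.

(** Listing the lattice points makes it possible to compare their numbers by
    injections. *)
Lemma lattice_points_exist : exists L : R -> R -> seq 'rV[int]_d,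
  (forall x y, uniq (L x y)) /\ forall x y c, c \in L x y <-> lattice_in x y c.
Proof.
have /choice [box boxP] := lattice_in_box.
exists (fun x y => [seq c <- undup (box (x + y)) | `[< lattice_in x y c >]]); split.
  by move=> x y; rewrite filter_uniq // undup_uniq.
move=> x y c; rewrite mem_filter; split=> [/andP[/asboolP]//|H].
apply/andP; split; first exact/asboolP.
by rewrite mem_undup; exact: boxP H.
Qed.

Lemma lattice_inD x y x' y' a b : lattice_in x y a -> lattice_in x' y' b ->
  lattice_in (x + x') (y + y') (a + b).
Proof.
move=> [w [w0 wx wy aE]] [w' [w'0 w'x w'y bE]].
exists (fun i => w i + w' i); split.
- by move=> i; rewrite addr_ge0.
- by rewrite big_split /= wx w'x.
- by rewrite big_split /= wy w'y.
- rewrite realifyD aE bE -big_split; apply: eq_bigr => i _.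
  by rewrite scalerDl.
Qed.

Lemma card_lattice_points P1 P2 (L : R -> R -> seq 'rV[int]_d) (r : rat * rat) x y :
  (forall x y, uniq (L x y)) -> (forall x y c, c \in L x y <-> lattice_in x y c) ->
  minkowski_sum (dilate r.1 P1) (dilate r.2 P2) =
    mixed_hull col (fun i => realify (v i)) x y ->
  lattice_count P1 P2 r = (size (L x y))%:R.
Proof.
move=> Lu memL E; rewrite /lattice_count E; congr (_%:R).
have -> : mixed_hull col (fun i => realify (v i)) x y `&` int_points (d := d) =
    [set` [seq realify c | c <- L x y]].
  apply/seteqP; split => u /=.
    move=> [Hu [c _ cu]]; apply/mapP; exists c => //.
    by apply/memL; rewrite /lattice_in /realify cu.
  move=> /mapP[c /memL Hc ->]; split => //.
  by exists c.
rewrite -[RHS](size_map realify) -(undup_id (s := map _ _)); last first.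
  by rewrite map_inj_uniq //; exact: realify_inj.
rewrite (_ : [set` undup _] = [set` [fset c in [seq realify c | c <- L x y]]%fset]).
  by rewrite set_fsetK card_fseq.
by apply/seteqP; split => u /=; rewrite mem_undup inE.
Qed.

End LatticePoints.

(** * Generation and translation of lattice points *)

Lemma degxE bs e : size e = size bs ->
  degx bs e = (\sum_(i < size bs) (if nth false bs i then nth 0 e i else 0))%N.
Proof.
elim: bs e => [|b bs IH] [|k e] //= => [_|[es]]; first by rewrite big_ord0.
by rewrite big_ord_recl /= -IH // /degx; case: b.
Qed.

Lemma degyE bs e : size e = size bs ->
  degy bs e = (\sum_(i < size bs) (if nth false bs i then 0 else nth 0 e i))%N.
Proof.
elim: bs e => [|b bs IH] [|k e] //= => [_|[es]]; first by rewrite big_ord0.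
by rewrite big_ord_recl /= -IH // /degy; case: b.
Qed.

Section Generation.
Variables (R : realType) (d N : nat) (col : pred 'I_N) (v : 'I_N -> 'rV[int]_d).
Variable L : R -> R -> seq 'rV[int]_d.
Hypothesis L_uniq : forall x y, uniq (L x y).
Hypothesis memL : forall x y c, c \in L x y <-> lattice_in col v x y c.

Let bs := [tuple col i | i < N].
Let vs := [tuple v i | i < N].
Let gs : seq ('rV[int]_d * nat * nat) :=
  [seq (g, st.1, st.2) | st <- [seq (s, t) | s <- iota 0 N.+1, t <- iota 0 N.+1],
                         g <- L st.1%:R st.2%:R].

Let lin_combE e : lin_comb vs e = \sum_i v i *+ nth 0%N e i.
Proof.
rewrite /lin_comb size_tuple; apply: eq_bigr => i _.
by rewrite -tnth_nth tnth_mktuple.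
Qed.

Let degx_col e : size e = N -> degx bs e = (\sum_(i | col i) nth 0 e i)%N.
Proof.
move=> eN; rewrite degxE ?size_tuple // [RHS]big_mkcond; apply: eq_bigr => i _.
by rewrite -tnth_nth tnth_mktuple.
Qed.

Let degy_col e : size e = N -> degy bs e = (\sum_(i | ~~ col i) nth 0 e i)%N.
Proof.
move=> eN; rewrite degyE ?size_tuple // [RHS]big_mkcond; apply: eq_bigr => i _.
by rewrite -tnth_nth tnth_mktuple if_neg.
Qed.

Let lattice_in_generators (e : 'I_N -> nat) :
  lattice_in (R := R) col v (\sum_(i | col i) e i)%N%:R
    (\sum_(i | ~~ col i) e i)%N%:R (\sum_i v i *+ e i).
Proof.
exists (fun i => (e i)%:R); split; rewrite ?natr_sum //.
rewrite realify_sum; apply: eq_bigr => i _; exact: realifyMn.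
Qed.

(** Rounding all weights down leaves weights below 1; so the sums of what remains
    are at most [N], and there are finitely many possible [g]. *)
Let floor_decomposition (s t : nat) c : lattice_in (R := R) col v s%:R t%:R c ->
  exists (e : 'I_N -> nat) (s' t' : nat) g,
    [/\ (s' <= N)%N, (t' <= N)%N, lattice_in (R := R) col v s'%:R t'%:R g &
      [/\ c = g + \sum_i v i *+ e i, s = (s' + \sum_(i | col i) e i)%N &
          t = (t' + \sum_(i | ~~ col i) e i)%N]].
Proof.
move=> [w [w0 ws wt cE]].
pose e i := Num.truncn (w i).
have e1 i : (e i)%:R <= w i by rewrite truncn_le.
have e2 i : w i < (e i).+1%:R by rewrite truncnS_gt.
have part (P : pred 'I_N) (n : nat) : \sum_(i | P i) w i = n%:R ->
   (\sum_(i | P i) e i <= n)%N /\ (n - \sum_(i | P i) e i <= N)%N.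
  move=> wn; have le1 : (\sum_(i | P i) e i <= n)%N.
    by rewrite -(ler_nat R) natr_sum -wn ler_sum.
  split => //; rewrite -(ler_nat R) natrB // natr_sum -wn -sumrB.
  apply: (@le_trans _ _ (\sum_(i | P i) 1)).
    apply: ler_sum => i _; rewrite lerBlDl; apply: ltW; move: (e2 i).
    by rewrite -natr1.
  rewrite big_const iter_addr addr0 ler_nat.
  by rewrite (leq_trans (max_card _)) // card_ord.
have [s1 s2] := part _ _ ws; have [t1 t2] := part _ _ wt.
exists e, (s - \sum_(i | col i) e i)%N, (t - \sum_(i | ~~ col i) e i)%N.
exists (c - \sum_i v i *+ e i); split => //; last by rewrite subrK !subnK.
exists (fun i => w i - (e i)%:R); split.
- by move=> i; rewrite subr_ge0.
- by rewrite natrB // natr_sum -ws sumrB.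
- by rewrite natrB // natr_sum -wt sumrB.
- rewrite realifyB realify_sum cE -sumrB.
  by apply: eq_bigr => i _; rewrite realifyMn scalerBl.
Qed.

(** The lattice points of all integral dilates form a module over the polynomial
    ring in the [v i], which is generated in degrees at most [N]. *)
Lemma EAM_lattice_points : EAM (fun s t => (size (L s%:R t%:R))%:R : rat).
Proof.
apply: (@EAM_graded_module _ _ bs vs gs) => [|s t|s t c]; first by rewrite !size_tuple.
  exact: L_uniq.
split=> [/memL /floor_decomposition [e [s' [t' [g [s'N t'N gin [cE sE tE]]]]]]|].
  have : (g, s', t') \in gs.
    apply/allpairsPdep; exists (s', t'), g; split => //; last exact/memL.
    by apply/allpairsP; exists (s', t'); rewrite !mem_iota.
  move=> /(nthP (0, 0%N, 0%N)) [i igs iE].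
  have [f [fN nE]] : exists f : seq nat, size f = N /\ forall j : 'I_N, nth 0%N f j = e j.
    exists [tuple e i | i < N]; split; first by rewrite size_tuple.
    by move=> j; rewrite -tnth_nth tnth_mktuple.
  exists i, f; split => //; first by rewrite size_tuple.
  rewrite /pointed iE /= lin_combE degx_col // degy_col // cE sE tE.
  by congr (_ + _, (_ + _)%N, (_ + _)%N); apply: eq_bigr => j _; rewrite nE.
move=> [i [e [igs es]]].
have /allpairsPdep[[s' t'] [g [_ /memL gin gE]]] := mem_nth (0, 0%N, 0%N) igs.
have eN : size e = N by rewrite es size_tuple.
rewrite /pointed gE /= lin_combE degx_col // degy_col //.
move=> [<- <- <-]; apply/memL; rewrite !natrD.
exact: (lattice_inD gin (lattice_in_generators _)).
Qed.

End Generation.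

Section Comparison.
Variables (R : realType) (d N : nat) (col : pred 'I_N) (v : 'I_N -> 'rV[int]_d).
Variable L : R -> R -> seq 'rV[int]_d.
Hypothesis L_uniq : forall x y, uniq (L x y).
Hypothesis memL : forall x y c, c \in L x y <-> lattice_in col v x y c.
Hypothesis spanning : forall u : 'rV[R]_d, exists a : 'I_N -> R,
  [/\ \sum_(i | col i) a i = 0, \sum_(i | ~~ col i) a i = 0 &
      u = \sum_i a i *: realify R (v i)].
Variables (i1 i2 : 'I_N).
Hypotheses (col1 : col i1) (col2 : ~~ col i2).

(** The weights [b i] have sums [x] and [y] but represent the origin, so adding or
    subtracting them passes between dilates that differ by (x, y) without moving
    any point. The weights may become negative; translation by a lattice vector
    [c] with weights larger than all [`|b i|] repairs this, and costs a dilation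
    by (m k1, m k2) that does not depend on [n]. *)
Lemma lattice_points_translate (k1 k2 : nat) (x y : R) :
  (0 < k1)%N -> (0 < k2)%N -> 0 <= x -> 0 <= y ->
  exists m : nat, forall n : nat,
    (size (L (x + (n * k1)%:R) (y + (n * k2)%:R)) <=
     size (L ((n + m) * k1)%:R ((n + m) * k2)%:R))%N /\
    (size (L (n * k1)%:R (n * k2)%:R) <=
     size (L (x + ((n + m) * k1)%:R) (y + ((n + m) * k2)%:R)))%N.
Proof.
move=> k10 k20 x0 y0.
have [a [a1 a2 aE]] := spanning (x *: realify R (v i1) + y *: realify R (v i2)).
pose b i := x * (i == i1)%:R + y * (i == i2)%:R - a i.
have b1 : \sum_(i | col i) b i = x.
  rewrite sumrB a1 subr0 big_split /= (bigD1 i1) //= eqxx mulr1 big1; last first.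
    by move=> i /andP[_ /negbTE ->]; rewrite mulr0.
  rewrite addr0 big1 ?addr0 // => i ci.
  by rewrite (_ : (i == i2) = false) ?mulr0 //; apply: contraTF ci => /eqP ->.
have b2 : \sum_(i | ~~ col i) b i = y.
  rewrite sumrB a2 subr0 big_split /= [X in X + _]big1; last first.
    move=> i ci; rewrite (_ : (i == i1) = false) ?mulr0 //.
    by apply: contraNF ci => /eqP ->.
  rewrite add0r (bigD1 i2) //= eqxx mulr1 big1 ?addr0 // => i /andP[_ /negbTE ->].
  by rewrite mulr0.
have bE : \sum_i b i *: realify R (v i) = 0.
  rewrite /b; under eq_bigr do rewrite scalerBl scalerDl.
  have delta z j : \sum_i (z * (i == j)%:R) *: realify R (v i) = z *: realify R (v j).
    rewrite (bigD1 j) //= eqxx mulr1 big1 ?addr0 // => i /negbTE ->.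
    by rewrite mulr0 scale0r.
  by rewrite sumrB -aE big_split /= !delta subrr.
have [B bB] : exists B : nat, forall i, `|b i| <= B%:R.
  exists (\sum_i Num.bound `|b i|)%N => i.
  apply: (le_trans (ltW (archi_boundP (normr_ge0 _)))).
  by rewrite ler_nat (bigD1 i) //= leq_addr.
pose m := (B * N)%N.
pose cx := (\sum_(i | col i) B)%N; pose cy := (\sum_(i | ~~ col i) B)%N.
have cxm : (cx <= m * k1)%N.
  rewrite (@leq_trans m) ?leq_pmulr // /cx sum_nat_const mulnC leq_mul //.
  by rewrite (leq_trans (max_card _)) ?card_ord.
have cym : (cy <= m * k2)%N.
  rewrite (@leq_trans m) ?leq_pmulr // /cy sum_nat_const mulnC leq_mul //.
  by rewrite (leq_trans (max_card _)) ?card_ord.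
(* Everybody gets [B]; the rest of [m * k1] and [m * k2] goes to [i1] and [i2]. *)
pose C i := (B + (m * k1 - cx) * (i == i1) + (m * k2 - cy) * (i == i2))%N.
have C1 : (\sum_(i | col i) C i = m * k1)%N.
  rewrite !big_split /= -/cx -!big_distrr /= [X in (_ + (_ - _) * X + _)%N](bigD1 i1) //=.
  rewrite eqxx !big1; first by rewrite addn0 muln1 muln0 addn0 subnKC.
    by move=> i ci; apply/eqP; rewrite eqb0; apply: contraTneq ci => ->.
  by move=> i /andP[_ /negbTE ->].
have C2 : (\sum_(i | ~~ col i) C i = m * k2)%N.
  rewrite !big_split /= -/cy -!big_distrr /= [X in (_ + _ + (_ - _) * X)%N](bigD1 i2) //=.
  rewrite eqxx !big1; first by rewrite addn0 muln1 muln0 addn0 subnKC.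
    by move=> i /andP[_ /negbTE ->].
  by move=> i ci; apply/eqP; rewrite eqb0; apply: contraNneq ci => ->.
have CB i : B%:R <= (C i)%:R :> R by rewrite ler_nat /C -addnA leq_addr.
pose c := \sum_i v i *+ C i.
have cE : realify R c = \sum_i (C i)%:R *: realify R (v i).
  by rewrite realify_sum; apply: eq_bigr => i _; rewrite realifyMn.
have move_in (eps x1 y1 x2 y2 : R) : `|eps| <= 1 ->
    x2 = x1 + eps * x + (m * k1)%:R -> y2 = y1 + eps * y + (m * k2)%:R ->
    (size (L x1 y1) <= size (L x2 y2))%N.
  move=> eps1 xE yE; rewrite -(size_map (fun g => g + c)); apply: uniq_leq_size.
    by rewrite map_inj_uniq // => g h /addIr.
  move=> _ /mapP[g /memL [w [w0 wx wy gE]] ->]; apply/memL.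
  exists (fun i => w i + eps * b i + (C i)%:R); split.
  - move=> i; rewrite -addrA addr_ge0 // -lerBlDr sub0r.
    have : `|eps * b i| <= (C i)%:R.
      rewrite normrM (le_trans _ (le_trans (bB i) (CB i))) //.
      by rewrite -[leRHS]mul1r ler_wpM2r.
    by rewrite ler_norml => /andP[].
  - by rewrite !big_split /= -mulr_sumr b1 wx xE -natr_sum C1.
  - by rewrite !big_split /= -mulr_sumr b2 wy yE -natr_sum C2.
  - under [RHS]eq_bigr do rewrite !scalerDl -scalerA.
    by rewrite realifyD gE cE !big_split /= -scaler_sumr bE scaler0 addr0.
(* The two inclusions use opposite signs of the correction [b]. *)
exists m => n; split.
  by apply: (move_in (-1)); rewrite ?normrN1 // mulN1r mulnDl natrD; ring.
by apply: (move_in 1); rewrite ?normr1 // mul1r mulnDl natrD; ring.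
Qed.

End Comparison.

(** * Full dimension *)

(** Let [base] select one member of each colour. The vectors [v i - v (base i)]
    span a space containing all differences of points of the hull, hence
    everything, and combinations of them have weights of sum 0 in each colour. *)
Lemma full_dim_spanning (R : realType) (d N : nat) (col : pred 'I_N)
    (v : 'I_N -> 'rV[R]_d) x y i1 i2 :
  col i1 -> ~~ col i2 -> has_dim (mixed_hull col v x y) d ->
  forall u : 'rV[R]_d, exists a : 'I_N -> R,
  [/\ \sum_(i | col i) a i = 0, \sum_(i | ~~ col i) a i = 0 & u = \sum_i a i *: v i].
Proof.
move=> c1 c2 [_ [V [dimV _ minV]]] u.
pose base i := if col i then i1 else i2.
have base_sum (k : 'I_N -> R) : \sum_i k i *: (v i - v (base i)) =
    \sum_i k i *: v i - (\sum_(i | col i) k i) *: v i1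
                      - (\sum_(i | ~~ col i) k i) *: v i2.
  under eq_bigr do rewrite scalerBr.
  rewrite sumrB -addrA -opprD; congr (_ - _).
  rewrite (bigID col) /= !scaler_suml; congr (_ + _); apply: eq_bigr => i ci.
    by rewrite /base ci.
  by rewrite /base (negbTE ci).
pose W := (\sum_i <[v i - v (base i)]>)%VS.
have VW : (V <= W)%VS.
  apply: minV => _ _ [w [_ w1 w2 ->]] [w' [_ w'1 w'2 ->]].
  have -> : \sum_i w i *: v i - \sum_i w' i *: v i =
      \sum_i (w i - w' i) *: (v i - v (base i)).
    rewrite base_sum !sumrB w1 w'1 w2 w'2 !subrr !scale0r !subr0 -sumrB.
    by apply: eq_bigr => i _; rewrite scalerBl.
  by apply: memv_sumr => i _; rewrite memvZ // memv_line.
have uW : u \in W.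
  apply: (subvP VW); rewrite (_ : V = fullv) ?memvf //.
  by apply/eqP; rewrite eqEdim subvf dimvf dimV dim_matrix mul1r leqnn.
have /memv_sumP[u_ u_in ->] := uW.
have /choice[k kE] : forall i, exists k, u_ i = k *: (v i - v (base i)).
  by move=> i; have /vlineP[k ->] := u_in i isT; exists k.
pose S1 := \sum_(i | col i) k i; pose S2 := \sum_(i | ~~ col i) k i.
exists (fun i => k i - S1 * (i == i1)%:R - S2 * (i == i2)%:R); split.
- rewrite !sumrB -/S1 -!mulr_sumr (bigD1 i1) //= eqxx !big1.
  + by rewrite addr0 mulr1 subrr mulr0 subr0.
  + by move=> i ci; case: eqP ci c2 => // -> ->.
  + by move=> i /andP[_ /negbTE ->].
- rewrite !sumrB -/S2 -!mulr_sumr [X in _ - _ - _ * X](bigD1 i2) //= eqxx !big1.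
  + by rewrite addr0 mulr1 mulr0 subr0 subrr.
  + by move=> i /andP[_ /negbTE ->].
  + by move=> i ci; case: eqP ci c1 => // -> /negbTE ->.
- under eq_bigr do rewrite kE.
  have delta z j : \sum_i (z * (i == j)%:R) *: v i = z *: v j.
    rewrite (bigD1 j) //= eqxx mulr1 big1 ?addr0 // => i /negbTE ->.
    by rewrite mulr0 scale0r.
  rewrite base_sum -/S1 -/S2 -(delta S1 i1) -(delta S2 i2) -!sumrB.
  by apply: eq_bigr => i _; rewrite !scalerBl.
Qed.

(** * The normal form of a sum of dilates *)

Lemma dilate_one (R : realType) d (P : set 'rV[R]_d) : dilate 1 P = P.
Proof.
apply/seteqP; split => [_ [x Px <-]|x Px]; first by rewrite rmorph1 scale1r.
by exists x => //; rewrite rmorph1 scale1r.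
Qed.

(** The family consists of the vertices of the integral polytopes
    [dilate tau.1 P1] and [dilate tau.2 P2], with respect to which [r] becomes
    r / tau. *)
Lemma mixed_dilate_hull (R : realType) (d : nat) (P1 P2 : set 'rV[R]_d)
    (tau : rat * rat) :
  minkowski_sum P1 P2 !=set0 ->
  0 < tau.1 -> integral_polytope (dilate tau.1 P1) ->
  0 < tau.2 -> integral_polytope (dilate tau.2 P2) ->
  exists (N : nat) (col : pred 'I_N) (v : 'I_N -> 'rV[int]_d),
    [/\ (exists i, col i), (exists i, ~~ col i) &
     forall r : rat * rat, 0 <= r.1 -> 0 <= r.2 ->
       minkowski_sum (dilate r.1 P1) (dilate r.2 P2) =
       mixed_hull col (fun i => realify R (v i))
         (ratr (r.1 / tau.1)) (ratr (r.2 / tau.2))].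
Proof.
move=> [_ [p1 P1p1 [p2 P2p2 _]]] t1 /integral_polytope_hull[n [z zE]].
move=> t2 /integral_polytope_hull[m [y yE]].
exists (n + m)%N, (fun i => if fintype.split i is inl _ then true else false).
exists (fun i => match fintype.split i with inl j => z j | inr j => y j end).
have pos k (u : 'I_k -> 'rV[R]_d) P p (s : rat) :
    dilate s P = conv_hull u -> P p -> (0 < k)%N.
  move=> E Pp; have : conv_hull u (ratr s *: p) by rewrite -E; exists p.
  case: k u {E} => // u [w [_ + _]]; rewrite big_ord0 => /eqP.
  by rewrite eq_sym oner_eq0.
split.
- exists (lshift m (Ordinal (pos _ _ _ _ _ zE P1p1))).
  by rewrite (unsplitK (inl _ : 'I_n + 'I_m)).
- exists (rshift n (Ordinal (pos _ _ _ _ _ yE P2p2))).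
  by rewrite (unsplitK (inr _ : 'I_n + 'I_m)).
move=> r r1 r2.
rewrite (dilate_hull _ t1 zE r1); last by exists p1.
rewrite (dilate_hull _ t2 yE r2); last by exists p2.
rewrite minkowski_sum_hull; congr (mixed_hull _ _ _ _).
by apply/funext => i; case: fintype.split.
Qed.

(** * Closed regions and locally closed cells *)

Lemma continuous_weighted_sum (R : realType) N (P : pred 'I_N) (a : 'I_N -> R) :
  continuous (fun w : 'rV[R]_N => \sum_(i | P i) w ord0 i * a i).
Proof.
apply: continuous_big; first exact: add_continuous.
move=> i _ w; apply: continuousM; first exact: coord_continuous.
exact: cst_continuous.
Qed.

(** The bound [M] confines the weights to a compact set, of which the region is
    a continuous image. *)
Lemma closed_mixed_hull_region (R : realType) (d N : nat) (col : pred 'I_N)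
    (v : 'I_N -> 'rV[R]_d) (p : 'rV[R]_d) (M : R) :
  closed [set u : R * R | [/\ u.1 <= M, u.2 <= M & mixed_hull col v u.1 u.2 p]].
Proof.
pose f (w : 'rV[R]_N) :=
  (\sum_(i | col i) w ord0 i * 1, \sum_(i | ~~ col i) w ord0 i * 1).
pose K := [set w : 'rV[R]_N | forall i, [set x | x \in `[0, M]] (w ord0 i)] `&`
  ([set w | (f w).1 <= M] `&` [set w | (f w).2 <= M] `&`
   \bigcap_(k in [set: 'I_d]) [set w : 'rV[R]_N | \sum_i w ord0 i * v i ord0 k = p ord0 k]).
have -> : [set u : R * R | [/\ u.1 <= M, u.2 <= M & mixed_hull col v u.1 u.2 p]] = f @` K.
  have pE (w : 'I_N -> R) : (p = \sum_i w i *: v i) <->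
      (forall k, \sum_i w i * v i ord0 k = p ord0 k).
    split=> [-> k|H]; first by rewrite summxE; apply: eq_bigr => i _; rewrite mxE.
    apply/rowP => k; rewrite -H summxE; apply: eq_bigr => i _; by rewrite mxE.
  apply/seteqP; split => [[x y] [/= xM yM [w [w0 wx wy /pE wp]]]|_ [w [wM [[fx fy] wp]] <-]].
    exists (\row_i w i); last first.
      by congr pair; rewrite -?wx -?wy; apply: eq_bigr => i _; rewrite mxE mulr1.
    split; last split; first 1 last.
    - by rewrite /f; split => /=; under eq_bigr do rewrite mxE mulr1; rewrite ?wx ?wy.
    - by move=> k _ /=; rewrite -wp; apply: eq_bigr => i _; rewrite mxE.
    move=> i /=; rewrite mxE in_itv /= w0 /=.
    have [ci|ci] := boolP (col i).
      by apply: le_trans xM; rewrite -wx (bigD1 i) //= lerDl sumr_ge0.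
    by apply: le_trans yM; rewrite -wy (bigD1 i) //= lerDl sumr_ge0.
  split => //; exists (fun i => w ord0 i); split.
  - by move=> i; have /= := wM i; rewrite in_itv /= => /andP[].
  - by apply: eq_bigr => i _; rewrite mulr1.
  - by apply: eq_bigr => i _; rewrite mulr1.
  - by apply/pE => k; exact: (wp k I).
apply: compact_closed; first exact: norm_hausdorff.
apply: continuous_compact.
  apply: continuous_subspaceT => w.
  apply: (@cvg_pair _ _ _ (nbhs w) (nbhs (f w).1) (nbhs (f w).2));
    exact: continuous_weighted_sum.
apply: compact_closedI.
  by apply: (@rV_compact R N (fun=> [set` `[0, M]])) => i; exact: segment_compact.
apply: closedI.
  have clP P : forall A : set R, closed A ->
      closed ((fun w : 'rV[R]_N => \sum_(i | P i) w ord0 i * 1) @^-1` A).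
    by apply/continuous_closedP; exact: continuous_weighted_sum.
  by apply: closedI; exact: (clP _ _ (@closed_le _ M)).
apply: closed_bigI => k _.
have clk : forall A : set R, closed A ->
    closed ((fun w : 'rV[R]_N => \sum_i w ord0 i * v i ord0 k) @^-1` A).
  by apply/continuous_closedP; exact: continuous_weighted_sum.
exact: (clk _ (@closed_eq _ (p ord0 k))).
Qed.

Lemma closed_mixed_hull_affine (R : realType) (d N : nat) (col : pred 'I_N)
    (v : 'I_N -> 'rV[R]_d) (p : 'rV[R]_d) (M a1 b1 a2 b2 : R) :
  closed [set u : R * R | [/\ u.1 * a1 + b1 <= M, u.2 * a2 + b2 <= M &
    mixed_hull col v (u.1 * a1 + b1) (u.2 * a2 + b2) p]].
Proof.
have cont : continuous (fun u : R * R => (u.1 * a1 + b1, u.2 * a2 + b2)).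
  move=> u; apply: (@cvg_pair _ _ _ (nbhs u) (nbhs (u.1 * a1 + b1)) (nbhs (u.2 * a2 + b2))).
    by apply: cvgD; [apply: cvgM; [exact: cvg_fst|exact: cvg_cst]|exact: cvg_cst].
  by apply: cvgD; [apply: cvgM; [exact: cvg_snd|exact: cvg_cst]|exact: cvg_cst].
have H := @closed_mixed_hull_region R d N col v p M.
exact: ((continuous_closedP _).1 cont _ H).
Qed.

Section HalfOpenBox.
Variables (R : realType) (t1 t2 : R).
Hypotheses (t1_gt0 : 0 < t1) (t2_gt0 : 0 < t2).

(** A fundamental domain of the open quadrant for the translations by natural
    multiples of [t1] and [t2]. *)
Definition half_open_box : set (R * R) :=
  [set u | [/\ 0 < u.1, u.1 <= t1, 0 < u.2 & u.2 <= t2]].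

Lemma half_open_box_bounded : bounded_set half_open_box.
Proof.
exists (Num.max t1 t2); split; first exact: num_real.
move=> M tM u [u1 u1t u2 u2t] /=.
rewrite /Num.Def.normr /= ge_max !gtr0_norm //.
by rewrite (le_trans u1t) ?(le_trans u2t) //; move: tM; rewrite gt_max => /andP[/ltW ? /ltW].
Qed.

Lemma half_open_box_cover (x : R * R) : 0 < x.1 -> 0 < x.2 ->
  exists (u : R * R) (m1 m2 : nat), half_open_box u /\
    x = u + (m1%:R * t1, m2%:R * t2).
Proof.
have one (y t : R) : 0 < y -> 0 < t -> exists m : nat, 0 < y - m%:R * t <= t.
  move=> y0 t0; have : exists m : nat, y <= m.+1%:R * t.
    exists (Num.truncn (y / t)); rewrite -ler_pdivrMr // ltW //.
    exact: truncnS_gt.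
  move=> /[dup] ex _; pose m := ex_minn ex; exists m.
  rewrite /m; case: ex_minnP => {}m Hm min.
  rewrite lerBlDr; have := Hm; rewrite -natr1 mulrDl mul1r addrC => ->.
  rewrite andbT subr_gt0.
  case: m Hm min => [|m] _ min; first by rewrite mul0r.
  rewrite ltNge; apply/negP => /min; by rewrite ltnn.
move=> x1 x2; have [m1 H1] := one _ _ x1 t1_gt0; have [m2 H2] := one _ _ x2 t2_gt0.
exists (x.1 - m1%:R * t1, x.2 - m2%:R * t2), m1, m2; split.
  by case/andP: H1 => *; case/andP: H2.
by case: x {x1 x2 H1 H2} => x y; congr pair; rewrite /= subrK.
Qed.

Lemma locally_closed_cell (Q : finType) (C : Q -> set (R * R)) (T : {ffun Q -> bool}) :
  (forall q, closed (C q)) ->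
  locally_closed (half_open_box `&` [set u | forall q, C q u <-> T q]).
Proof.
move=> clC.
exists ([set u | 0 < u.1] `&` [set u | 0 < u.2] `&` ~` \bigcup_(q in [set q | ~~ T q]) C q).
exists ([set u | u.1 <= t1] `&` [set u | u.2 <= t2] `&` \bigcap_(q in [set q | T q]) C q).
have oP (g : R * R -> R) : continuous g -> open [set u | 0 < g u].
  by move=> /continuousP cg; exact: (cg _ (@open_gt _ 0)).
have cP (g : R * R -> R) t : continuous g -> closed [set u | g u <= t].
  by move=> /continuous_closedP cg; exact: (cg _ (@closed_le _ t)).
have cfst : continuous (fst : R * R -> R) by move=> u; exact: cvg_fst.
have csnd : continuous (snd : R * R -> R) by move=> u; exact: cvg_snd.
split.
- apply: openI; first apply: openI.
  + exact: oP cfst.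
  + exact: oP csnd.
  + apply: closed_openC; apply: closed_bigcup => [|q _]; last exact: clC.
    exact: finite_finset.
- apply: closedI; first apply: closedI.
  + exact: cP cfst.
  + exact: cP csnd.
  + by apply: closed_bigI.
apply/seteqP; split => u.
  move=> [[u1 u1t u2 u2t] H]; split.
    by split => //; move=> [q /negP Tq] /H.
  by split => // q /= Tq; apply/H.
move=> [[[u1 u2] nC] [[u1t u2t] CC]]; split => //= q; split=> [Cq|/CC //].
by apply: contrapT => /negP Tq; apply: nC; exists q.
Qed.

End HalfOpenBox.

(** * Coefficients of the quasi-polynomial *)

Section QuasiPolynomial.
Variables (R : realType) (d N : nat) (col : pred 'I_N) (v : 'I_N -> 'rV[int]_d).
Variable L : R -> R -> seq 'rV[int]_d.
Hypothesis L_uniq : forall x y, uniq (L x y).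
Hypothesis memL : forall x y c, c \in L x y <-> lattice_in col v x y c.
Variables (tau : rat * rat) (F : rat * rat -> rat) (p : nat -> nat -> rat * rat -> rat).
Hypotheses (tau1 : 0 < tau.1) (tau2 : 0 < tau.2).
Hypothesis FL : forall r : rat * rat, 0 <= r.1 -> 0 <= r.2 ->
  F r = (size (L (ratr (r.1 / tau.1)) (ratr (r.2 / tau.2))))%:R.
Hypothesis hp : quasi_polynomial_expansion d tau F p.

Lemma coef_periodic l1 l2 (r : rat * rat) k1 k2 :
  (l1 + l2 <= d)%N -> 0 <= r.1 -> 0 <= r.2 ->
  p l1 l2 (r.1 + k1%:R * tau.1, r.2 + k2%:R * tau.2) = p l1 l2 r.
Proof.
move=> ld r1 r2.
have mul0 (k : nat) (t : rat) : 0 < t -> 0 <= k%:R * t by move=> t0; rewrite mulr_ge0 // ltW.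
elim: k1 => [|k1 <-].
  rewrite mul0r addr0; elim: k2 => [|k2 <-]; first by rewrite mul0r addr0 -surjective_pairing.
  have [|| _ E] := hp.1 l1 l2 ld (r.1, r.2 + k2%:R * tau.2) => //=.
    by rewrite addr_ge0 ?mul0.
  by rewrite -{}E /= -natr1 mulrDl mul1r addrA.
have [|| E _] := hp.1 l1 l2 ld (r.1 + k1%:R * tau.1, r.2 + k2%:R * tau.2) => /=.
- by rewrite addr_ge0 ?mul0.
- by rewrite addr_ge0 ?mul0.
by rewrite -{}E /= -natr1 mulrDl mul1r addrA.
Qed.

(** By periodicity the counts along r + N^2 tau are the values of one polynomial,
    whose coefficients are those of the quasi-polynomial at [r]. *)
Lemma value_shift (r : rat * rat) k1 k2 : 0 <= r.1 -> 0 <= r.2 ->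
  bipoly_value d (fun i j => p i j r) (r.1 + k1%:R * tau.1) (r.2 + k2%:R * tau.2) =
  (size (L (ratr (r.1 / tau.1) + k1%:R) (ratr (r.2 / tau.2) + k2%:R)))%:R.
Proof.
move=> r1 r2.
have E0 (x : rat) (k : nat) (t : rat) : 0 < t ->
    ratr ((x + k%:R * t) / t) = ratr (x / t) + k%:R :> R.
  by move=> t0; rewrite mulrDl mulfK ?gt_eqF // rmorphD /= ratr_nat.
rewrite -!E0 // -(FL (r := (r.1 + k1%:R * tau.1, r.2 + k2%:R * tau.2))) /=; first last.
- by rewrite addr_ge0 // mulr_ge0 // ltW.
- by rewrite addr_ge0 // mulr_ge0 // ltW.
rewrite hp.2 /=; first last.
- by rewrite addr_ge0 // mulr_ge0 // ltW.
- by rewrite addr_ge0 // mulr_ge0 // ltW.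
by apply: eq_bigr => i _; apply: eq_bigr => j ij; rewrite coef_periodic.
Qed.

(** These are mixed volumes up to positive factors. On the multiples of [tau] the
    quasi-polynomial is a polynomial and counts the points of a finitely
    generated bigraded set. *)
Lemma top_coef_ge0 a b : (a + b = d)%N -> 0 <= p a b (0, 0).
Proof.
move=> abd; suff : 0 <= p a b (0, 0) * tau.1 ^+ a * tau.2 ^+ b.
  by rewrite pmulr_lge0 ?exprn_gt0 // pmulr_lge0 ?exprn_gt0.
apply: (EAM_top_coef_ge0 (c := fun a b => p a b (0, 0) * tau.1 ^+ a * tau.2 ^+ b) _ abd).
move: (EAM_lattice_points L_uniq memL); congr (EAM _).
apply/funext => s; apply/funext => t.
have := @value_shift (0, 0) s t (lexx 0) (lexx 0).
rewrite /= !mul0r rmorph0 !add0r => <-.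
apply: eq_bigr => i _; apply: eq_bigr => j _; rewrite !exprMn; ring.
Qed.

Section TopConstant.
Hypothesis spanning : forall u : 'rV[R]_d, exists a : 'I_N -> R,
  [/\ \sum_(i | col i) a i = 0, \sum_(i | ~~ col i) a i = 0 &
      u = \sum_i a i *: realify R (v i)].
Variables (i1 i2 : 'I_N).
Hypotheses (col1 : col i1) (col2 : ~~ col i2).

(** The counts along [r] and along 0 bound each other up to a translation by [m],
    which does not affect the top form. *)
Lemma top_coef_constant l (r : rat * rat) : (l <= d)%N -> 0 <= r.1 -> 0 <= r.2 ->
  p l (d - l)%N r = p l (d - l)%N (0, 0).
Proof.
move=> ld r1 r2; move: l ld.
apply: (top_form_inj (c := fun a b => p a b r) (e := fun a b => p a b (0, 0)) tau1 tau2).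
move=> k1 k2 k10 k20.
have x0 : 0 <= ratr (r.1 / tau.1) :> R by rewrite ler0q divr_ge0 // ltW.
have y0 : 0 <= ratr (r.2 / tau.2) :> R by rewrite ler0q divr_ge0 // ltW.
have [m Hm] := lattice_points_translate L_uniq memL spanning col1 col2 k10 k20 x0 y0.
have V0 n1 n2 : bipoly_value d (fun i j => p i j (0, 0)) (n1%:R * tau.1) (n2%:R * tau.2) =
    (size (L n1%:R n2%:R))%:R.
  have := @value_shift (0, 0) n1 n2 (lexx 0) (lexx 0).
  by rewrite /= !mul0r rmorph0 !add0r => <-.
have expand (n k : nat) (t : rat) : n%:R * (k%:R * t) = (n * k)%N%:R * t.
  by rewrite natrM mulrA.
have expand' (n k : nat) (t : rat) : m%:R * (k%:R * t) + n%:R * (k%:R * t) =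
    ((n + m) * k)%N%:R * t.
  by rewrite natrM natrD; ring.
apply/eqP; rewrite eq_le; apply/andP; split.
  apply: (top_form_le (x0 := r.1) (y0 := r.2) (x1 := m%:R * (k1%:R * tau.1))
     (y1 := m%:R * (k2%:R * tau.2))) => n.
  rewrite !expand' V0 !expand value_shift // ler_nat.
  exact: (Hm n).1.
apply: (top_form_le (x0 := 0) (y0 := 0) (x1 := r.1 + m%:R * (k1%:R * tau.1))
     (y1 := r.2 + m%:R * (k2%:R * tau.2))) => n.
rewrite !add0r -!addrA !expand' !expand V0 value_shift // ler_nat.
exact: (Hm n).2.
Qed.

End TopConstant.

(** The values of [F] at the interpolation nodes r + k tau. *)
Definition grid_value (r : rat * rat) (k : nat * nat) : rat :=
  (size (L (ratr (r.1 / tau.1) + k.1%:R) (ratr (r.2 / tau.2) + k.2%:R)))%:R.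

Lemma coef_formula : exists c1 c2 : nat -> nat -> {poly rat},
  forall (r : rat * rat) l1 l2, 0 <= r.1 -> 0 <= r.2 -> (l1 + l2 <= d)%N ->
  p l1 l2 r = \sum_(k1 < d.+1) \sum_(k2 < d.+1)
    grid_value r (val k1, val k2) * ((c1 k1 l1).[r.1] * (c2 k2 l2).[r.2]).
Proof.
have [c1 [c2 H]] := coef_interpolation2 d (lt0r_neq0 tau1) (lt0r_neq0 tau2).
exists c1, c2 => r l1 l2 r1 r2 ld.
have := H (fun i j => if (i + j <= d)%N then p i j r else 0) r.1 r.2 l1 l2.
rewrite ld => ->; try by lia.
apply: eq_bigr => k1 _; apply: eq_bigr => k2 _; congr (_ * _).
rewrite /grid_value /= -value_shift //; apply: eq_bigr => i _.
rewrite [RHS]big_mkcond; apply: eq_bigr => j _.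
by case: ifP; rewrite ?mul0r.
Qed.

Section Cells.
Variable box : seq 'rV[int]_d.
Hypothesis box_in : forall (x y : R) c, x + y <= (d.+1 + d.+1)%:R ->
  lattice_in col v x y c -> c \in box.

Local Notation Q := ('I_d.+1 * 'I_d.+1 * 'I_(size box))%type.

(** On the half-open box the two bounds hold automatically; they make the set
    closed by compactness. *)
Definition region (q : Q) : set (R * R) :=
  [set u | [/\ u.1 * (ratr tau.1)^-1 + q.1.1%:R <= d.+1%:R,
               u.2 * (ratr tau.2)^-1 + q.1.2%:R <= d.+1%:R &
               mixed_hull col (fun i => realify R (v i))
                 (u.1 * (ratr tau.1)^-1 + q.1.1%:R) (u.2 * (ratr tau.2)^-1 + q.1.2%:R)
                 (realify R box`_q.2)]].

Definition cell (T : {ffun Q -> bool}) : set (R * R) :=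
  half_open_box (ratr tau.1) (ratr tau.2) `&` [set u | forall q, region q u <-> T q].

(** Lattice points outside [box] are not reached from the half-open box, and the
    others are selected by the same [T]. *)
Lemma grid_value_cell T r s k : cell T (ratr2 R r) -> cell T (ratr2 R s) ->
  (k.1 <= d)%N -> (k.2 <= d)%N -> grid_value r k = grid_value s k.
Proof.
move=> Tr Ts k1 k2; congr (_%:R); apply/perm_size/uniq_perm => //.
suff sub r' s' : cell T (ratr2 R r') -> cell T (ratr2 R s') ->
   {subset L (ratr (r'.1 / tau.1) + k.1%:R) (ratr (r'.2 / tau.2) + k.2%:R) <=
           L (ratr (s'.1 / tau.1) + k.1%:R) (ratr (s'.2 / tau.2) + k.2%:R)}.
  by move=> c; apply/idP/idP; apply: sub.
move=> [[r1 r1t r2 r2t] HT] [_ HT'] c /memL cin; apply/memL.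
have le1 (x t : rat) (n : nat) : 0 < t -> (ratr x : R) <= ratr t -> (n <= d)%N ->
    ratr (x / t) + n%:R <= d.+1%:R :> R.
  move=> t0 xt nd; rewrite -natr1 addrC lerD ?ler_nat // fmorph_div.
  by rewrite ler_pdivrMr ?ltr0q // mul1r.
have cbox : c \in box.
  by apply: box_in cin; rewrite natrD lerD // le1.
have [j jb jE] := nthP 0 cbox.
have k1' : (k.1 < d.+1)%N by []. have k2' : (k.2 < d.+1)%N by [].
pose q : Q := (Ordinal k1', Ordinal k2', Ordinal jb).
have : region q (ratr2 R s').
  apply/HT'/HT; split; rewrite /= -!fmorph_div ?jE //; exact: le1.
by move=> [_ _]; rewrite /= -!fmorph_div jE.
Qed.

Lemma locally_closed_region_cell T : locally_closed (cell T).
Proof. by apply: locally_closed_cell => q; exact: closed_mixed_hull_affine. Qed.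

Lemma cell_cover u : half_open_box (ratr tau.1) (ratr tau.2) u -> exists T, cell T u.
Proof.
move=> bu; exists [ffun q => `[< region q u >]]; split => // q /=.
by rewrite ffunE; split=> /asboolP.
Qed.

Lemma grid_value_bound r k : half_open_box (ratr tau.1) (ratr tau.2) (ratr2 R r) ->
  (k.1 <= d)%N -> (k.2 <= d)%N -> `|grid_value r k| <= (size box)%:R.
Proof.
move=> [r1 r1t r2 r2t] k1 k2.
have le1 (x t : rat) (n : nat) : 0 < t -> (ratr x : R) <= ratr t -> (n <= d)%N ->
    ratr (x / t) + n%:R <= d.+1%:R :> R.
  move=> t0 xt nd; rewrite -natr1 addrC lerD ?ler_nat // fmorph_div.
  by rewrite ler_pdivrMr ?ltr0q // mul1r.
rewrite ger0_norm ?ler0n // ler_nat; apply: uniq_leq_size => // c /memL cin.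
by apply: box_in cin; rewrite natrD lerD // le1.
Qed.

(** By periodicity it suffices to look at the half-open box, where the counts and
    the polynomials of [coef_formula] are bounded. *)
Lemma coef_bounded l1 l2 : (l1 + l2 <= d)%N ->
  exists B : rat, forall r : rat * rat, 0 < r.1 -> 0 < r.2 -> `|p l1 l2 r| <= B.
Proof.
move=> ld; have [c1 [c2 coefE]] := coef_formula.
pose b1 (k : nat) := sval (poly_itv_bound (c1 k l1) 0 tau.1).
pose b2 (k : nat) := sval (poly_itv_bound (c2 k l2) 0 tau.2).
exists (\sum_(k1 < d.+1) \sum_(k2 < d.+1) (size box)%:R * (b1 k1 * b2 k2)).
move=> r r1 r2.
have T1 : 0 < ratr tau.1 :> R by rewrite ltr0q.
have T2 : 0 < ratr tau.2 :> R by rewrite ltr0q.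
have [|| u [m1 [m2 [bu uE]]]] := half_open_box_cover T1 T2 (x := ratr2 R r).
- by rewrite ltr0q.
- by rewrite ltr0q.
pose s : rat * rat := (r.1 - m1%:R * tau.1, r.2 - m2%:R * tau.2).
have su : ratr2 R s = u.
  move: uE; case: u {bu} => x y [E1 E2].
  by rewrite /ratr2 /= !rmorphB !rmorphM /= !ratr_nat E1 E2 !addrK.
move: bu; rewrite -su => bs; have [] := bs.
rewrite /= !ltr0q !ler_rat => s1 s1t s2 s2t.
have -> : p l1 l2 r = p l1 l2 s.
  rewrite -(coef_periodic (r := s) m1 m2 ld (ltW s1) (ltW s2)) /s /= !subrK.
  by rewrite -surjective_pairing.
rewrite (coefE s _ _ (ltW s1) (ltW s2) ld) (le_trans (ler_norm_sum _ _ _)) //.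
apply: ler_sum => k1 _.
rewrite (le_trans (ler_norm_sum _ _ _)) //; apply: ler_sum => k2 _.
rewrite normrM; apply: ler_pM; rewrite ?normr_ge0 //.
  by apply: grid_value_bound => //=; rewrite -ltnS.
rewrite normrM; apply: ler_pM; rewrite ?normr_ge0 //.
  by rewrite /b1; case: poly_itv_bound => b /= Hb; apply: Hb; rewrite (ltW s1).
by rewrite /b2; case: poly_itv_bound => b /= Hb; apply: Hb; rewrite (ltW s2).
Qed.

End Cells.

End QuasiPolynomial.

(** * The theorem *)

Theorem theorem4p14 (R : realType) (d : nat) (P1 P2 : set 'rV[R]_d)
    (tau : rat * rat) (p : nat -> nat -> rat * rat -> rat)
    (hP1 : rational_polytope P1) (hP2 : rational_polytope P2)
    (hdim : has_dim (minkowski_sum P1 P2) d)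
    (htau1 : is_rational_denominator P1 tau.1)
    (htau2 : is_rational_denominator P2 tau.2)
    (hp : quasi_polynomial_expansion d tau (lattice_count P1 P2) p) :
  (exists (S : set (set (R * R)))
          (f : set (R * R) -> nat -> nat -> {poly {poly rat}}),
     [/\ finite_set S,
         forall U, S U ->
           [/\ U `<=` pos_quadrant R, locally_closed U & bounded_set U],
         pos_quadrant R =
           \bigcup_(U in S) \bigcup_(u in [set: nat * nat]) shift_set tau U u &
         forall U, S U -> forall r : rat * rat, 0 < r.1 -> 0 < r.2 ->
           U (ratr2 R r) ->
           forall l1 l2 : nat, (l1 + l2 <= d)%N ->
             p l1 l2 r = (f U l1 l2).[r.1, r.2]]) /\
  (exists C : nat -> nat -> rat,
     (forall l1 l2 : nat, (l1 + l2 <= d)%N -> 0 <= C l1 l2) /\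
     forall r : rat * rat, 0 < r.1 -> 0 < r.2 ->
       (forall l1 l2 : nat, (l1 + l2 <= d)%N -> `|p l1 l2 r| <= C l1 l2) /\
       (forall l1 : nat, (l1 <= d)%N -> p l1 (d - l1)%N r = C l1 (d - l1)%N)).
Proof.
have [t1 int1 _] := htau1; have [t2 int2 _] := htau2.
have [N [col [v [[i1 c1] [i2 c2] hull]]]] := mixed_dilate_hull hdim.1 t1 int1 t2 int2.
have [L [L_uniq memL]] := lattice_points_exist R col v.
have FL (r : rat * rat) : 0 <= r.1 -> 0 <= r.2 -> lattice_count P1 P2 r =
    (size (L (ratr (r.1 / tau.1)) (ratr (r.2 / tau.2))))%:R.
  by move=> r1 r2; apply: (card_lattice_points L_uniq memL); exact: hull.
have spanning : forall u : 'rV[R]_d, exists a : 'I_N -> R,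
    [/\ \sum_(i | col i) a i = 0, \sum_(i | ~~ col i) a i = 0 &
        u = \sum_i a i *: realify R (v i)].
  apply: (full_dim_spanning c1 c2 (x := ratr (1 / tau.1)) (y := ratr (1 / tau.2))).
  by rewrite -(hull (1, 1)) //= !dilate_one.
have [q1 [q2 coefE]] := coef_formula t1 t2 FL hp.
have [box box_in] := lattice_in_box col v ((d.+1 + d.+1)%:R : R).
pose cl := @cell R d N col v tau box.
have T1 : 0 < ratr tau.1 :> R by rewrite ltr0q.
have T2 : 0 < ratr tau.2 :> R by rewrite ltr0q.
split.
  (* On a cell without rational points the choice of polynomials is immaterial. *)
  pose sample (U : set (R * R)) : rat * rat := xget (0, 0) [set r | U (ratr2 R r)].
  exists (range (cl)).
  exists (fun U l1 l2 => \sum_(k1 < d.+1) \sum_(k2 < d.+1)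
    (grid_value L tau (sample U) (val k1, val k2))%:P%:P *
      (map_poly polyC (q1 k1 l1) * (q2 k2 l2)%:P)).
  split.
  - exact/finite_image/finite_finset.
  - move=> _ [T _ <-]; split.
    + by move=> u [[]].
    + exact: locally_closed_region_cell.
    + have [M [Mr HM]] := half_open_box_bounded (ratr tau.1 : R) (ratr tau.2).
      by exists M; split=> // x Mx u [bu _]; exact: (HM x Mx u bu).
  - apply/seteqP; split => u; last first.
      move=> [_ [T _ <-] [k _ [w [[w1 _ w2 _] _] <-]]].
      rewrite /pos_quadrant /= !rmorphM /= !ratr_nat.
      by split; rewrite ltr_pwDl // mulr_ge0 // ltW.
    move=> [u1 u2]; have [w [m1 [m2 [bw ->]]]] := half_open_box_cover T1 T2 u1 u2.
    have [T Tw] := cell_cover col v box bw.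
    exists (cl T) => //; exists (m1, m2) => //; exists w => //.
    by rewrite /ratr2 /= !rmorphM /= !ratr_nat.
  move=> _ [T _ <-] r r1 r2 Ur l1 l2 ld.
  have Us : cl T (ratr2 R (sample (cl T))).
    by apply: (@xgetPex _ (0, 0) [set s | cl T (ratr2 R s)]); exists r.
  rewrite (coefE _ _ _ (ltW r1) (ltW r2) ld) !horner_sum; apply: eq_bigr => k1 _.
  rewrite !horner_sum; apply: eq_bigr => k2 _.
  rewrite !(hornerM, hornerC) horner_map /= hornerC; congr (_ * _).
  by apply: (grid_value_cell L_uniq memL t1 t2 box_in Ur Us); rewrite /= -ltnS.
have [B BP] : exists B : nat -> nat -> rat, forall l1 l2, (l1 + l2 <= d)%N ->
    forall r : rat * rat, 0 < r.1 -> 0 < r.2 -> `|p l1 l2 r| <= B l1 l2.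
  have /choice[B BP] : forall l : nat * nat, exists b : rat, (l.1 + l.2 <= d)%N ->
      forall r : rat * rat, 0 < r.1 -> 0 < r.2 -> `|p l.1 l.2 r| <= b.
    move=> [l1 l2]; have [ld|] := leqP (l1 + l2)%N d; last by exists 0.
    by have [b Hb] := coef_bounded L_uniq memL t1 t2 FL hp box_in ld; exists b.
  by exists (fun l1 l2 => B (l1, l2)) => l1 l2 /(BP (l1, l2)).
have top_ge0 := top_coef_ge0 L_uniq memL t1 t2 FL hp.
have top_const := top_coef_constant L_uniq memL t1 t2 FL hp spanning c1 c2.
exists (fun l1 l2 => if (l1 + l2 == d)%N then p l1 l2 (0, 0) else B l1 l2).
split=> [l1 l2 ld|r r1 r2].
  case: eqP => [/top_ge0 //|_]; apply: le_trans (BP _ _ ld tau t1 t2).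
  exact: normr_ge0.
have topE l1 : (l1 <= d)%N -> p l1 (d - l1)%N r = p l1 (d - l1)%N (0, 0).
  by move=> ld; apply: top_const => //; exact: ltW.
split=> [l1 l2 ld|l1 ld]; last by rewrite subnKC // eqxx topE.
case: eqP => [E|_]; last exact: BP.
have l2E : l2 = (d - l1)%N by rewrite -E addKn.
by rewrite l2E topE ?ger0_norm ?top_ge0 // ?subnKC // -E leq_addr.
Qed.
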